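(* Let $\lambda$ be a partition of length at most $n$ and let $\tau\in S_n/\mathrm{Stab}(\lambda)$ (a minimal length coset representative). Then $$\bar\pi_\tau(\mathbf{x}^\lambda)=\sum_{\pi\in\widehat\Pi_\tau(\lambda)}\mathbf{x}^{\pi(1)},$$ that is, the Demazure atom $\bar\pi_\tau(\mathbf{x}^\lambda)$ is the sum of the weights of all Lakshmibai-Seshadri paths of shape $\lambda$ beginning in the direction $\tau(\lambda)$.
   Context: Pad $\lambda$ with zeros to length $n$. $S_n$ acts on $\mathbb{R}^n$ on the left by permuting coordinates, $s_i$ exchanging coordinates $i$ and $i+1$, and on $\mathbb{Z}[x_1,\dots,x_n]$ by permuting variables. $\mathbf{x}^\beta=x_1^{\beta_1}\cdots x_n^{\beta_n}$. Demazure atoms. For $1\le i<n$ define operators on $\mathbb{Z}[x_1,\dots,x_n]$: $\partial_i=\frac{1-s_i}{x_i-x_{i+1}}$, $\pi_i=\partial_ix_i$ (i.e. $\pi_i(f)=\partial_i(x_if)$), $\bar\pi_i=\pi_i-1$. The $\bar\pi_i$ satisfy the braid relations, so $\bar\pi_\tau=\bar\pi_{i_1}\cdots\bar\pi_{i_k}$ is well defined for any reduced word $\tau=s_{i_1}\cdots s_{i_k}$. The Demazure atom is $\bar\pi_\tau(\mathbf{x}^\lambda)$. LS-paths. $\mathrm{Stab}(\lambda)$ is the stabilizer of $\lambda$ in $S_n$; $S_n/\mathrm{Stab}(\lambda)$ is identified with the set of minimal length coset representatives, with length $\ell$ and Bruhat order. Roots are $e_a-e_b$ ($a\neq b$), positive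 if $a<b$; $s_\beta$ is the reflection (transposition) of a root $\beta$, and $\langle\cdot,\cdot\rangle$ is the standard inner product on $\mathbb{R}^n$. A rational path of shape $\lambda$ is a pair $\pi=(\underline\tau;\underline a)$ with $\underline\tau:\tau_1>\cdots>\tau_r$ a strictly decreasing sequence (Bruhat order) in $S_n/\mathrm{Stab}(\lambda)$ and $\underline a:0=a_0<a_1<\cdots<a_r=1$ rational numbers; it is identified with the piecewise linear map $\pi\colon[0,1]\to\mathbb{R}^n$ given by $\pi(t)=\sum_{i=1}^{j-1}(a_i-a_{i-1})\tau_i(\lambda)+(t-a_{j-1})\tau_j(\lambda)$ for $t\in[a_{j-1},a_j]$, $j=1,\dots,r$. Its weight is $\pi(1)$. For $\tau>\sigma$ in $S_n/\mathrm{Stab}(\lambda)$ and rational $0<a<1$, an $a$-chain for $(\tau,\sigma)$ is a sequence $\tau=\kappa_0>\kappa_1>\cdots>\kappa_s=\sigma$ in $S_n/\mathrm{Stab}(\lambda)$ such that $\ell(\kappa_i)=\ell(\kappa_{i-1})-1$ and $a\langle\kappa_i(\lambda),\beta_i\rangle\in\mathbb{Z}$ for each $i=1,\dots,s$, where $\beta_i$ is the positive root with $\kappa_i=s_{\beta_i}\kappa_{i-1}$. A rational path $\pi=(\underline\tau;\underline a)$ of shape $\lambda$ is a Lakshmibai-Seshadri path (LS-path) of shape $\lambda$ if for each $1\le i\le r-1$ there is an $a_i$-chain for $(\tau_i,\tau_{i+1})$. For an LS-path one has $\pi(1)\in\mathbb{Z}^n$. $\widehat\Pi_\tau(\lambda)$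 is the set of LS-paths $\pi=(\underline\omega;\underline a)$ of shape $\lambda$ with first element $\omega_1=\tau$. *)

(* Defs.v *)
From mathcomp Require Export all_boot all_order all_algebra all_fingroup.
From mathcomp Require Import zify.
From mathcomp Require Export mpoly.
From mathcomp Require Export boolp classical_sets fsbigop.

Set Implicit Arguments.
Unset Strict Implicit.
Unset Printing Implicit Defensive.

Import Order.TTheory GRing.Theory Num.Theory.

Local Open Scope ring_scope.

Definition is_partition (lam : seq nat) : bool :=
  sorted geq lam && (0%N \notin lam).

Definition pad (n : nat) (lam : seq nat) : 'X_{1..n} :=
  [multinom nth 0%N lam i | i < n].

(* The product of the group ['S_n] applies its left factor first; [pcomp] is
   composition of functions, under which 'S_n acts on the left. *)
Definition pcomp (n : nat) (s t : 'S_n) : 'S_n := (t * s)%g.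

Lemma ltn_simple_hi (n : nat) (i : 'I_n.-1) : (i.+1 < n)%N.
Proof. by case: n i => [|n] [i Hi]. Qed.

(* Everything is indexed from 0: [i : 'I_n.-1] stands for the simple
   transposition of the positions [i] and [i.+1]. *)
Definition simple_lo (n : nat) (i : 'I_n.-1) : 'I_n := widen_ord (leq_pred n) i.
Definition simple_hi (n : nat) (i : 'I_n.-1) : 'I_n := Ordinal (ltn_simple_hi i).

Definition simple_perm (n : nat) (i : 'I_n.-1) : 'S_n :=
  tperm (simple_lo i) (simple_hi i).

(* The length on S_n as the number of inversions; [length_word_le] and
   [ex_reduced_word] below identify it with the length with respect to the
   simple transpositions. *)
Definition perm_length (n : nat) (s : 'S_n) : nat :=
  #|[pred p : 'I_n * 'I_n | (p.1 < p.2)%N && (s p.2 < s p.1)%N]|.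

Definition word_perm (n : nat) (w : seq 'I_n.-1) : 'S_n :=
  foldr (fun i s => pcomp (simple_perm i) s) 1%g w.

Definition reduced_word (n : nat) (w : seq 'I_n.-1) (s : 'S_n) : bool :=
  (word_perm w == s) && (size w == perm_length s).

Lemma simple_permE (n : nat) (i : 'I_n.-1) (x : 'I_n) :
  simple_perm i x
  = (if x == i :> nat then i.+1 else if x == i.+1 :> nat then i : nat else x) :> nat.
Proof.
rewrite /simple_perm; case: tpermP => [->|->|/eqP H1 /eqP H2] /=.
- by rewrite eqxx.
- by rewrite eqn_leq ltnn eqxx.
- by move: H1 H2; rewrite -!val_eqE /= => /negPf-> /negPf->.
Qed.

Lemma simple_permK (n : nat) (i : 'I_n.-1) (s : 'S_n) :
  pcomp (simple_perm i) (pcomp (simple_perm i) s) = s.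
Proof. by rewrite /pcomp -mulgA tperm2 mulg1. Qed.

Lemma perm_length_simple (n : nat) (i : 'I_n.-1) (s : 'S_n) :
  ((s^-1)%g (simple_lo i) < (s^-1)%g (simple_hi i))%N ->
  perm_length (pcomp (simple_perm i) s) = (perm_length s).+1.
Proof.
set x := (s^-1)%g _; set y := (s^-1)%g _ => ltxy.
have sx : s x = simple_lo i by rewrite permKV.
have sy : s y = simple_hi i by rewrite permKV.
rewrite /perm_length.
rewrite -[RHS]add1n.
have <- : ((x, y) \notin [pred p : 'I_n * 'I_n | (p.1 < p.2)%N && (s p.2 < s p.1)%N])
  = 1%N :> nat by rewrite inE /= sx sy ltxy /= ltnNge leqnSn.
rewrite -cardU1; apply: eq_card => -[u v]; rewrite !inE /= /pcomp !permM.
rewrite !simple_permE xpair_eqE.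
have E (z z' : 'I_n) : (s z == s z' :> nat) = (z == z' :> nat).
  by rewrite !val_eqE (inj_eq (@perm_inj _ s)).
have [Eux Euy Evx Evy Euv] := And5 (E u x) (E u y) (E v x) (E v y) (E u v).
move: Eux Euy Evx Evy Euv ltxy; rewrite sx sy /= -!val_eqE /=.
move: (s u : nat) (s v : nat) (x : nat) (y : nat) (u : nat) (v : nat).
move: (i : nat) => {x y u v sx sy E} k A B x y u v.
by case: (A =P k); case: (A =P k.+1); case: (B =P k); case: (B =P k.+1); lia.
Qed.

Lemma perm_length_desc (n : nat) (i : 'I_n.-1) (s : 'S_n) :
  ((s^-1)%g (simple_hi i) < (s^-1)%g (simple_lo i))%N ->
  perm_length s = (perm_length (pcomp (simple_perm i) s)).+1.
Proof.
move=> H; rewrite -[in LHS](simple_permK i s) perm_length_simple //.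
by rewrite /pcomp invMg !permM tpermV tpermL tpermR.
Qed.

Lemma perm_length_simple_le (n : nat) (i : 'I_n.-1) (s : 'S_n) :
  (perm_length (pcomp (simple_perm i) s) <= (perm_length s).+1)%N.
Proof.
case: (ltngtP ((s^-1)%g (simple_lo i)) ((s^-1)%g (simple_hi i))) => H.
- by rewrite perm_length_simple.
- rewrite (perm_length_desc H); exact/leqW/leqW.
- have /perm_inj/(congr1 val)/= /eqP := val_inj H.
  by rewrite eqn_leq ltnn andbF.
Qed.

Lemma perm_length1 (n : nat) : perm_length (1 : 'S_n)%g = 0%N.
Proof.
apply: eq_card0 => -[u v]; rewrite !inE /= !perm1.
by case: ltngtP.
Qed.

Lemma length_word_le (n : nat) (w : seq 'I_n.-1) :
  (perm_length (word_perm w) <= size w)%N.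
Proof.
elim: w => [|i w IHw] /=; first by rewrite perm_length1.
exact: leq_trans (perm_length_simple_le _ _) _.
Qed.

Lemma ex_descent (n : nat) (s : 'S_n) : s != 1%g ->
  exists i : 'I_n.-1, ((s^-1)%g (simple_hi i) < (s^-1)%g (simple_lo i))%N.
Proof.
move=> s1; apply/existsP; apply/contraR: s1; rewrite negb_exists => /forallP H.
suff /eqP : (s^-1)%g == 1%g by rewrite -(inj_eq invg_inj) invg1 => ->.
have mono (x y : 'I_n) : (x < y)%N -> ((s^-1)%g x < (s^-1)%g y)%N.
  case: x y => x Hx [y Hy] /= ; elim: y Hy => // y IHy Hy.
  rewrite ltnS leq_eqVlt => Hxy.
  have Hy1 : (y < n.-1)%N by lia.
  have step : ((s^-1)%g (simple_lo (Ordinal Hy1)) < (s^-1)%g (simple_hi (Ordinal Hy1)))%N.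
    move: (H (Ordinal Hy1)); rewrite -leqNgt leq_eqVlt => /orP[/eqP/val_inj|//].
    by move/perm_inj/(congr1 val)=> /= /eqP; rewrite eqn_leq ltnn andbF.
  have -> : Ordinal Hy = simple_hi (Ordinal Hy1) by apply: val_inj.
  case/orP: Hxy => [/eqP Exy|ltxy].
    by have -> : Ordinal Hx = simple_lo (Ordinal Hy1) by apply: val_inj.
  apply: ltn_trans step; have -> : simple_lo (Ordinal Hy1) = Ordinal (ltnW Hy) by apply: val_inj.
  exact: IHy.
have mono' (x y : 'I_n) : (x < y)%N -> (s x < s y)%N.
  apply: contraTT; rewrite -!leqNgt leq_eqVlt => /orP[/eqP/val_inj/perm_inj->//|].
  by move/mono; rewrite !permK => /ltnW.
have ge (t : 'S_n) : (forall x y : 'I_n, x < y -> t x < t y)%N ->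
    forall x : 'I_n, (x <= t x)%N.
  move=> t_mono [x]; elim: x => // x IHx Hx.
  by apply: leq_ltn_trans (IHx (ltnW Hx)) _; apply: t_mono.
apply/eqP/permP => x; rewrite perm1; apply: val_inj; apply/eqP.
rewrite eqn_leq ge // andbT.
by have := ge s mono' ((s^-1)%g x); rewrite permKV.
Qed.

Lemma ex_reduced_word (n : nat) (s : 'S_n) : exists w, reduced_word w s.
Proof.
move Ek : (perm_length s) => k; elim: k s Ek => [|k IHk] s Ek.
  exists [::]; rewrite /reduced_word Ek eqxx andbT /= eq_sym.
  apply/negPn/negP => /ex_descent[i Hi].
  suff : (0 < perm_length s)%N by rewrite Ek.
  apply/card_gt0P; exists ((s^-1)%g (simple_hi i), (s^-1)%g (simple_lo i)).
  by rewrite inE /= Hi !permKV /=.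
have [|i Hi] := @ex_descent n s.
  by apply: contra_eqN Ek => /eqP->; rewrite perm_length1.
have E : perm_length s = (perm_length (pcomp (simple_perm i) s)).+1.
  exact: perm_length_desc.
have [|w /andP[/eqP Ew /eqP sw]] := IHk (pcomp (simple_perm i) s).
  by move: E; rewrite Ek => -[].
by exists (i :: w); rewrite /reduced_word /= Ew simple_permK eqxx sw E eqxx.
Qed.

Definition bruhat_step (n : nat) : rel 'S_n := fun s t =>
  [exists a : 'I_n, exists b : 'I_n,
     [&& a != b, t == pcomp (tperm a b) s & (perm_length s < perm_length t)%N]].

Definition bruhat_lt (n : nat) : rel 'S_n := fun s t =>
  (s != t) && connect (@bruhat_step n) s t.

Lemma msym_tperm_dvd (n : nat) (a b : 'I_n) (f : {mpoly int[n]}) :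
  exists g : {mpoly int[n]}, ('X_a - 'X_b) * g == f - msym (tperm a b) f.
Proof.
set s := tperm a b.
pose P (f : {mpoly int[n]}) :=
  exists g : {mpoly int[n]}, ('X_a - 'X_b) * g = f - msym s f.
have PC c : P c%:MP by exists 0; rewrite mulr0 /msym mmapC subrr.
have PX i : P 'X_i.
  rewrite /P /msym mmapX mmap1U /s.
  case: tpermP => [->|->|_ _].
  - by exists 1; rewrite mulr1.
  - by exists (-1); rewrite mulrN1 opprB.
  - by exists 0; rewrite mulr0 subrr.
have PD f1 f2 : P f1 -> P f2 -> P (f1 + f2).
  move=> [g1 E1] [g2 E2]; exists (g1 + g2).
  by rewrite mulrDr E1 E2 msymD opprD addrACA.
have PM f1 f2 : P f1 -> P f2 -> P (f1 * f2).
  move=> [g1 E1] [g2 E2]; exists (g1 * f2 + msym s f1 * g2).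
  rewrite mulrDr mulrA E1 mulrCA E2 msymM mulrBl mulrBr.
  by rewrite addrA subrK.
suff [g E] : P f by exists g; rewrite E.
elim/mpolyind: f => [|c m p _ _ Pp]; first by rewrite -mpolyC0; apply: (PC).
apply: (PD) => //; rewrite -mul_mpolyC; apply: (PM); first exact: (PC).
rewrite mpolyXE_id; apply: (big_ind P) => [||i _].
- by rewrite -mpolyC1; apply: (PC).
- exact: (PM).
elim: (m i) => [|k IHk]; first by rewrite expr0 -mpolyC1; apply: (PC).
by rewrite exprS; apply: (PM).
Qed.

(* [ddiff i f] is the quotient of [f - s_i f] by [x_i - x_{i+1}], which is exact
   by the previous lemma; see [ddiffP] and [ddiff_uniq]. *)
Definition ddiff (n : nat) (i : 'I_n.-1) (f : {mpoly int[n]}) : {mpoly int[n]} :=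
  xchoose (msym_tperm_dvd (simple_lo i) (simple_hi i) f).

Lemma ddiffP (n : nat) (i : 'I_n.-1) (f : {mpoly int[n]}) :
  ('X_(simple_lo i) - 'X_(simple_hi i)) * ddiff i f
  = f - msym (simple_perm i) f.
Proof. exact/eqP/(xchooseP (msym_tperm_dvd _ _ f)). Qed.

Lemma mpolyX_simple_neq (n : nat) (i : 'I_n.-1) :
  'X_(simple_lo i) - 'X_(simple_hi i) != 0 :> {mpoly int[n]}.
Proof.
rewrite subr_eq0; apply/eqP => /(congr1 (mcoeff U_(simple_lo i))).
rewrite !mcoeffX eqxx; case: eqP => // /(congr1 (fun m : 'X_{1..n} => m (simple_lo i))).
rewrite !mnm1E eqxx; case: eqP => // /(congr1 val) /= /eqP.
by rewrite eqn_leq ltnn.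
Qed.

Lemma ddiff_uniq (n : nat) (i : 'I_n.-1) (f g : {mpoly int[n]}) :
  ('X_(simple_lo i) - 'X_(simple_hi i)) * g = f - msym (simple_perm i) f ->
  g = ddiff i f.
Proof. by rewrite -ddiffP => /(mulfI (mpolyX_simple_neq i)). Qed.

Definition demazure_pi (n : nat) (i : 'I_n.-1) (f : {mpoly int[n]}) :=
  ddiff i ('X_(simple_lo i) * f).

Definition demazure_bpi (n : nat) (i : 'I_n.-1) (f : {mpoly int[n]}) :=
  demazure_pi i f - f.

Definition demazure_bpi_word (n : nat) (w : seq 'I_n.-1) (f : {mpoly int[n]}) :=
  foldr (@demazure_bpi n) f w.

(* All vectors that occur are rational, so R^n is replaced by Q^n. *)
Definition wvec (n : nat) (lam : 'X_{1..n}) : 'rV[rat]_n := \row_j (lam j)%:R.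

Definition pact (n : nat) (s : 'S_n) (v : 'rV[rat]_n) : 'rV[rat]_n :=
  \row_j v 0 ((s^-1)%g j).

Definition vdot (n : nat) (v w : 'rV[rat]_n) : rat := \sum_j v 0 j * w 0 j.

Definition root_vec (n : nat) (a b : 'I_n) : 'rV[rat]_n :=
  delta_mx 0 a - delta_mx 0 b.

Definition in_Stab (n : nat) (lam : 'X_{1..n}) (s : 'S_n) : bool :=
  pact s (wvec lam) == wvec lam.

(* S_n / Stab(lam), as the set of elements of minimal length in their coset
   s Stab(lam). *)
Definition min_rep (n : nat) (lam : 'X_{1..n}) (s : 'S_n) : bool :=
  [forall h : 'S_n, in_Stab lam h ==>
     (perm_length s <= perm_length (pcomp s h))%N].

(* A pair (tau_1, ..., tau_r; a_0, a_1, ..., a_r). *)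
Definition path_data (n : nat) : Type := (seq 'S_n * seq rat)%type.

Definition rational_path (n : nat) (lam : 'X_{1..n}) (p : path_data n) : bool :=
  [&& all (min_rep lam) p.1,
      sorted (fun s t => bruhat_lt t s) p.1,
      size p.2 == (size p.1).+1,
      head 0 p.2 == 0,
      last 0 p.2 == 1
    & sorted <%R p.2].

(* The piecewise linear map attached to [p], at [t] in [0, 1]: [j] is the
   0-based index of the first segment whose right end is at least [t]. *)
Definition path_at (n : nat) (lam : 'X_{1..n}) (p : path_data n) (t : rat) :
    'rV[rat]_n :=
  let j := find (fun a => t <= a) (behead p.2) in
  \sum_(i < j) (p.2`_i.+1 - p.2`_i) *: pact (nth 1%g p.1 i) (wvec lam)
  + (t - p.2`_j) *: pact (nth 1%g p.1 j) (wvec lam).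

Definition achain_step (n : nat) (lam : 'X_{1..n}) (a : rat) : rel 'S_n :=
  fun k k' =>
  [&& min_rep lam k, min_rep lam k', bruhat_lt k' k,
      perm_length k == (perm_length k').+1
    & [exists u : 'I_n, exists v : 'I_n,
        [&& (u < v)%N, k' == pcomp (tperm u v) k
          & a * vdot (pact k' (wvec lam)) (root_vec u v) \is a Num.int]]].

Definition has_achain (n : nat) (lam : 'X_{1..n}) (a : rat) (s t : 'S_n) : Prop :=
  exists ks : seq 'S_n, path (achain_step lam a) s ks /\ last s ks = t.

Definition LS_path (n : nat) (lam : 'X_{1..n}) (p : path_data n) : Prop :=
  rational_path lam p /\
  forall i : nat, (i.+1 < size p.1)%N ->
    has_achain lam p.2`_i.+1 (nth 1%g p.1 i) (nth 1%g p.1 i.+1).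

Definition LS_paths_from (n : nat) (lam : 'X_{1..n}) (tau : 'S_n) :
    set (path_data n) :=
  [set p | LS_path lam p /\ ohead p.1 = Some tau]%classic.

(* The exponent vector pi(1). Its coordinates are natural numbers whenever [p]
   is an LS-path, by [path_exponentE] below, so nothing is truncated. *)
Definition path_exponent (n : nat) (lam : 'X_{1..n}) (p : path_data n) :
    'X_{1..n} :=
  [multinom Num.truncn (path_at lam p 1 ord0 i) | i < n].

Lemma has_achain_int (n : nat) (lam : 'X_{1..n}) (a : rat) (s t : 'S_n) (j : 'I_n) :
  has_achain lam a s t ->
  a * (pact s (wvec lam) 0 j - pact t (wvec lam) 0 j) \is a Num.int.
Proof.
case=> ks [+ <-]; elim: ks s => [|k ks IHks] s /=; first by rewrite subrr mulr0.
case/andP=> /and5P[_ _ _ _ /existsP[u /existsP[v /and3P[ltuv /eqP Ek Hint]]]] Hp.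
rewrite -(subrK (pact k (wvec lam) 0 j) (pact s _ 0 j)) -addrA mulrDr.
rewrite rpredD ?IHks //.
have neuv : u != v by rewrite -val_eqE neq_ltn ltuv.
have Es : pact s (wvec lam) 0 j = pact k (wvec lam) 0 (tperm u v j).
  by rewrite !mxE Ek /pcomp invMg tpermV permM tpermK.
have Ed : vdot (pact k (wvec lam)) (root_vec u v)
    = pact k (wvec lam) 0 u - pact k (wvec lam) 0 v.
  rewrite /vdot /root_vec; move: (pact k _) => f.
  transitivity (\sum_i (f 0 i * (i == u)%:R - f 0 i * (i == v)%:R)).
    by apply: eq_bigr => i _; rewrite !mxE /= -mulrBr.
  rewrite sumrB; congr (_ - _).
    rewrite (bigD1 u) //= eqxx mulr1 big1 ?addr0 // => i /negPf->.
    exact: mulr0.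
  rewrite (bigD1 v) //= eqxx mulr1 big1 ?addr0 // => i /negPf->.
  exact: mulr0.
rewrite Es; move: Hint; rewrite Ed; case: tpermP => [->|->|_ _] Hint.
- by rewrite -rpredN -mulrN opprB.
- exact: Hint.
- by rewrite subrr mulr0.
Qed.

Lemma path_at1 (n : nat) (lam : 'X_{1..n}) (p : path_data n) :
  rational_path lam p ->
  path_at lam p 1 = \sum_(i < size p.1)
    (p.2`_i.+1 - p.2`_i) *: pact (nth 1%g p.1 i) (wvec lam).
Proof.
case/and5P=> _ _ /eqP szp /eqP hd0 /andP[/eqP last1 srt].
have [r Er] : exists r, size p.1 = r.+1.
  case Ep : (size p.1) szp => [|r] szp; last by exists r.
  by move: p.2 szp hd0 last1 => [//|a [|//]] /= _ -> /eqP; rewrite eq_sym oner_eq0.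
have szb : size (behead p.2) = r.+1 by rewrite size_behead szp Er.
have nthr : p.2`_r.+1 = 1 by rewrite -last1 -nth_last szp Er.
have Efind : find (fun a => 1 <= a) (behead p.2) = r.
  case: findP => [/negP[]|k ltk /(_ 0) Hk Hlt].
    by apply/(has_nthP 0); exists r; rewrite ?szb // nth_behead nthr.
  case: (ltngtP k r) => // H.
  - suff : p.2`_k.+1 < 1 by rewrite ltNge -nth_behead Hk.
    by rewrite -nthr; apply: (sorted_ltn_nth lt_trans) => //;
      rewrite inE szp Er // ltnS; apply: leqW.
  - by have := Hlt 0 r H; rewrite nth_behead nthr lexx.
by rewrite /path_at Efind Er big_ord_recr /= nthr.
Qed.

Lemma path_exponentE (n : nat) (lam : 'X_{1..n}) (p : path_data n) (i : 'I_n) :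
  LS_path lam p -> path_at lam p 1 ord0 i = (path_exponent lam p i)%:R.
Proof.
case=> Hp Hc; rewrite mnmE.
suff H : path_at lam p 1 ord0 i \is a Num.nat by rewrite truncnK.
rewrite natrEint (path_at1 Hp) summxE.
case/and5P: Hp => _ _ /eqP szp /eqP hd0 /andP[/eqP last1 srt].
set V := fun k => pact (nth 1%g p.1 k) (wvec lam) ord0 i.
have Vnat k : V k \is a Num.nat by rewrite /V !mxE.
rewrite (eq_bigr (fun k : 'I_ _ => (p.2`_k.+1 - p.2`_k) * V k)); last first.
  by move=> k _; rewrite mxE.
apply/andP; split; last first.
  apply: sumr_ge0 => k _; apply: mulr_ge0; last exact: natr_ge0.
  rewrite subr_ge0 ltW //; apply: (sorted_ltn_nth lt_trans) => //.
    by rewrite inE szp ltnS ltnW.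
  by rewrite inE szp ltnS.
have Hk k : (k < size p.1)%N ->
    \sum_(j < k.+1) (p.2`_j.+1 - p.2`_j) * V j - p.2`_k.+1 * V k \is a Num.int.
  elim: k => [|k IHk] ltk.
    by rewrite big_ord1 nth0 hd0 subr0 subrr.
  rewrite big_ord_recr /= mulrBl addrA addrAC addrK.
  have := rpredD (IHk (ltnW ltk)) (has_achain_int i (Hc k ltk)).
  by rewrite -/(V k) -/(V k.+1) mulrBr addrA subrK.
case Er : (size p.1) Hk => [|r] Hk; first by rewrite big_ord0.
have nthr : p.2`_r.+1 = 1 by rewrite -last1 -nth_last szp Er.
have Vint : V r \is a Num.int by apply: intr_nat.
by have := rpredD (Hk r (ltnSn r)) Vint; rewrite nthr mul1r subrK.
Qed.

(* Main.v *)
(** Write [x_j = y_j ^ N], with [N] divisible by all the differences of the parts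
    of [lambda].  Every turning time of an LS-path of shape [lambda] is then a
    multiple [k / N], so an LS-path is a walk in [N] steps on [S_n / Stab lambda]
    whose [k]-th transition is along the relation "there is a (k / N)-chain", and
    the generating function of the paths starting at [tau] is obtained by a
    transfer matrix recursion going backwards in time.

    Fix a simple reflection [s] and group [S_n / Stab lambda] into [s]-orbits.  For
    an orbit [p < s p], let [m = <p lambda, alpha>] and let [V], [V'] be the
    generating functions of the pieces of path on [k / N, 1] that start in the
    directions [p] and [s p].  With [z = x_i / x_{i+1}], they satisfy
      [(z - 1) V' = z ^ phi V - s V],
    where [phi] is the fractional part of [k m / N]; when this is an integer, [phi]
    is [0] before the transition at time [k / N] is applied and [1] afterwards.  For
    a one-element orbit, [V] is [s]-invariant.  Between two transitions, moving back
    in time multiplies [V] and [V'] by monomials exchanged by [s], which changes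
    [phi] as required.  A transition preserves these relations because its block
    between [{p, s p}] and [{q, s q}] is upper triangular with equal diagonal entries
    when [k m / N] is not an integer, and otherwise is zero or a matrix of ones, up
    to the vanishing of the entry from [p] to [s q].  At time [0] one has [phi = 0],
    and the relation says that [V'] is the image of [V] under the operator
    [bar pi_i]. *)

Require Import Defs.
From mathcomp Require Import zify ring.

Set Implicit Arguments.
Unset Strict Implicit.
Unset Printing Implicit Defensive.

Import Order.TTheory GRing.Theory Num.Theory.

Local Open Scope ring_scope.

(** * Increasing pairs of a function on positions *)

Section IncreasingPairs.

Variable n : nat.
Implicit Types (f g : 'I_n -> nat) (u v : 'I_n) (i : 'I_n.-1).
Local Open Scope nat_scope.

(** For [f] the weight of [s], this is the length of the minimal representative of the coset of [s]
    ([min_repE]), read off from the weight alone. *)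
Definition incr_pairs f : nat :=
  #|[pred p : 'I_n * 'I_n | (p.1 < p.2) && (f p.1 < f p.2)]|.

Definition fperm f (s : 'S_n) : 'I_n -> nat := fun u => f (s u).

Lemma eq_incr_pairs f g : f =1 g -> incr_pairs f = incr_pairs g.
Proof. by move=> fg; apply: eq_card => p; rewrite !inE !fg. Qed.

Lemma simple_lo_lt_hi i : simple_lo i < simple_hi i.
Proof. exact: ltnSn. Qed.

Lemma simple_permKK i : involutive (simple_perm i).
Proof. exact: tpermK. Qed.

Lemma ltn_simple_perm i u v :
  (u, v) != (simple_lo i, simple_hi i) -> (v, u) != (simple_lo i, simple_hi i) ->
  (simple_perm i u < simple_perm i v) = (u < v).
Proof.
rewrite !xpair_eqE -!val_eqE /= !simple_permE.
move: (u : nat) (v : nat) (i : nat) => a b k.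
by case: (a =P k); case: (a =P k.+1); case: (b =P k); case: (b =P k.+1); lia.
Qed.

(** The swap preserves the order of every pair of positions other than (lo, hi), which is counted
    apart. *)
Lemma incr_pairs_simple_lt f i : f (simple_lo i) < f (simple_hi i) ->
  incr_pairs f = (incr_pairs (fperm f (simple_perm i))).+1.
Proof.
move=> lt_f; pose e := (simple_lo i, simple_hi i).
rewrite /incr_pairs (cardD1 e) inE /= ltnSn lt_f; congr _.+1.
pose h (p : 'I_n * 'I_n) := (simple_perm i p.1, simple_perm i p.2).
have hK : involutive h by case=> u v; rewrite /h /= !simple_permKK.
rewrite -!sum1_card (reindex_inj (inv_inj hK)); apply: eq_bigl => -[u v].
rewrite !inE -[LHS]/[&& h (u, v) != e, _ & _] (inv_eq hK) /=.
have -> : h e = (simple_hi i, simple_lo i) by rewrite /h /= tpermL tpermR.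
have hi_lo : (simple_hi i < simple_lo i) = false.
  by apply/negbTE; rewrite -leqNgt ltnW // simple_lo_lt_hi.
have [[-> ->]|ne1] := eqVneq (u, v) e.
  by rewrite /fperm tpermL tpermR (ltnNge (f _)) (ltnW lt_f) hi_lo !andbF.
have [[-> ->]|ne2] /= := eqVneq; first by rewrite hi_lo.
by rewrite ltn_simple_perm //; apply: contraNneq ne2 => -[-> ->].
Qed.

Lemma comp_simple_permK f i : fperm (fperm f (simple_perm i)) (simple_perm i)
  =1 f.
Proof. by move=> u; rewrite /fperm simple_permKK. Qed.

Lemma incr_pairs_simple_gt f i : f (simple_hi i) < f (simple_lo i) ->
  incr_pairs (fperm f (simple_perm i)) = (incr_pairs f).+1.
Proof.
move=> lt_f; rewrite (@incr_pairs_simple_lt (fperm f _) i) /fperm ?tpermL ?tpermR //.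
by rewrite (eq_incr_pairs (comp_simple_permK f i)).
Qed.

Lemma incr_pairs_simple_eq f i : f (simple_hi i) = f (simple_lo i) ->
  incr_pairs (fperm f (simple_perm i)) = incr_pairs f.
Proof.
by move=> eq_f; apply: eq_incr_pairs => u; rewrite /fperm /simple_perm;
   case: tpermP => // ->.
Qed.

(** Induction on [v - u], writing (u v) = s_i (w v) s_i with w = u + 1. If the first swap lowers the
    count, the second raises it by at most one; otherwise [f w <= f u < f v], and the second swap
    lowers it. *)
Lemma incr_pairs_tperm f u v : u < v -> f u < f v ->
  incr_pairs (fperm f (tperm u v)) < incr_pairs f.
Proof.
move=> lt_uv; have [d] := ubnP (v - u); elim: d f u lt_uv => // d IHd f u lt_uv.
rewrite ltnS => le_d lt_f.
have ui : u < n.-1 by have := ltn_ord v; lia.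
pose i := Ordinal ui; have Eu : u = simple_lo i by apply: val_inj.
have [Ev|/eqP ne_v] := (simple_hi i =P v).
  by rewrite -Ev Eu -/(simple_perm i) (@incr_pairs_simple_lt f i) // Ev -Eu.
set w := simple_hi i; have lt_wv : w < v.
  by rewrite ltn_neqAle ne_v.
have E : fperm f (tperm u v) =1
    fperm (fperm (fperm f (simple_perm i)) (tperm w v)) (simple_perm i).
  move=> x; rewrite /fperm -!permM mulgA; congr (f (_ x)).
  rewrite -[X in (X * _ * _)%g]tpermV -mulgA -/(conjg _ _) tpermJ -Eu tpermR.
  by rewrite tpermD // -val_eqE /= neq_ltn ?lt_uv //;
    apply/orP; left; apply: lt_wv.
rewrite (eq_incr_pairs E); set g := fperm f (simple_perm i).
have gw : g w = f u by rewrite /g /fperm tpermR -Eu.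
have gu : g u = f w by rewrite /g /fperm Eu tpermL.
have gv : g v = f v.
  by rewrite /g /fperm tpermD // -val_eqE /= neq_ltn ?lt_uv //;
    apply/orP; left; apply: lt_wv.
have {IHd} /= := IHd g w lt_wv; rewrite gw gv; move=> /(_ _ lt_f) IHd.
have {IHd} IH : incr_pairs (fperm g (tperm w v)) < incr_pairs g.
  by apply: IHd; move: le_d; rewrite /w /=; lia.
set h := fperm g (tperm w v) in IH *.
have hw : h w = f v by rewrite /h /fperm tpermL.
have hu : h u = f w by rewrite /h /fperm tpermD // -val_eqE /= gtn_eqF // ltnW.
have gE := @incr_pairs_simple_lt f i; have gE' := @incr_pairs_simple_gt f i.
have gE'' := @incr_pairs_simple_eq f i.
have hE := @incr_pairs_simple_lt h i; have hE' := @incr_pairs_simple_gt h i.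
have hE'' := @incr_pairs_simple_eq h i.
move: gE gE' gE'' hE hE' hE''; rewrite -Eu -/w hw hu -/g.
case: (ltngtP (f u) (f w)) => [lt1|lt1|eq1] gE gE' gE'' hE hE' hE''.
- have {gE gE' gE''}gE := gE isT.
  case: (ltngtP (f w) (f v)) hE hE' hE'' => [_ H _ _|_ _ H _|eq2 _ _ H].
  + by have {}H := H isT; lia.
  + by have {}H := H isT; lia.
  + by have {}H := H (esym eq2); lia.
- have {gE gE' gE''}gE := gE' isT.
  have lt2 : f w < f v by exact: ltn_trans lt_f.
  by have {}hE := hE lt2; lia.
- have {gE gE' gE''}gE := gE'' (esym eq1).
  have lt2 : f w < f v by rewrite -eq1.
  by have {}hE := hE lt2; lia.
Qed.

End IncreasingPairs.

(** * Minimal coset representatives *)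

Definition weight (n : nat) (lam : 'X_{1..n}) (s : 'S_n) : 'X_{1..n} :=
  [multinom lam ((s^-1)%g j) | j < n].

Definition dominant (n : nat) (lam : 'X_{1..n}) : Prop :=
  forall p q : 'I_n, (p <= q)%N -> (lam q <= lam p)%N.

Section MinimalRepresentatives.

Variables (n : nat) (lam : 'X_{1..n}).
Hypothesis lam_dom : dominant lam.
Implicit Types (s t h : 'S_n) (u v : 'I_n) (i : 'I_n.-1).
Local Open Scope nat_scope.

Lemma weightE s u : weight lam s u = lam ((s^-1)%g u).
Proof. by rewrite mnmE. Qed.

Lemma weight_tperm s u v w :
  weight lam (pcomp (tperm u v) s) w = weight lam s (tperm u v w).
Proof. by rewrite !weightE /pcomp invMg tpermV permM. Qed.

Lemma perm_lengthE s :
  perm_length s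
  = #|[pred p : 'I_n * 'I_n | (p.1 < p.2) && ((s^-1)%g p.2 < (s^-1)%g p.1)]|.
Proof.
pose h (p : 'I_n * 'I_n) := (s p.2, s p.1).
have h_inj : injective h by case=> a b [c d] [] /perm_inj-> /perm_inj->.
rewrite /perm_length -!sum1_card [RHS](reindex_inj h_inj); apply: eq_bigl.
by case=> u v; rewrite !inE /= !permK andbC.
Qed.

(** Reversing the values turns inversions into increasing pairs, so that [incr_pairs_tperm] governs
    the length as well. *)
Lemma perm_length_incr_pairs s :
  perm_length s = incr_pairs (fun u => n - (s^-1)%g u).
Proof.
rewrite perm_lengthE; apply: eq_card => -[u v]; rewrite !inE /=.
by congr (_ && _); rewrite ltn_sub2lE // ltnW.
Qed.

Lemma perm_length_tperm s u v : u < v -> (s^-1)%g v < (s^-1)%g u ->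
  perm_length (pcomp (tperm u v) s) < perm_length s.
Proof.
move=> lt_uv lt_s; rewrite !perm_length_incr_pairs.
have := @incr_pairs_tperm _ (fun w => n - (s^-1)%g w) u v lt_uv.
have -> : n - (s^-1)%g u < n - (s^-1)%g v by rewrite ltn_sub2lE // ltnW.
move=> /(_ isT); congr (_ < _); apply: eq_incr_pairs => w.
by rewrite /fperm /pcomp invMg tpermV permM.
Qed.

Lemma in_StabP h : reflect (forall u, lam ((h^-1)%g u) = lam u) (in_Stab lam h).
Proof.
apply: (iffP eqP) => [/rowP H u|H]; last by apply/rowP => u; rewrite !mxE H.
by have := H u; rewrite !mxE => /eqP; rewrite eqr_nat => /eqP.
Qed.

Lemma weight_stab s h : in_Stab lam h -> weight lam (pcomp s h) = weight lam s.
Proof.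
by move/in_StabP=> H; apply/mnmP => u; rewrite !weightE /pcomp invMg permM H.
Qed.

Lemma weight_lt s u v :
  weight lam s u < weight lam s v -> (s^-1)%g v < (s^-1)%g u.
Proof. by rewrite !weightE !ltnNge; apply: contra => /lam_dom. Qed.

Lemma incr_pairs_weight_le s : incr_pairs (weight lam s) <= perm_length s.
Proof.
rewrite perm_lengthE /incr_pairs; apply: subset_leq_card.
apply/fintype.subsetP => -[u v].
by rewrite !inE /= => /andP[-> /weight_lt->].
Qed.

(** The count depends only on the coset and bounds the length of its elements from below. If the
    bound is strict at [s], some inversion of the inverse joins positions of equal weight, and
    exchanging these shortens [s] within its coset. *)
Lemma min_repE s : min_rep lam s = (perm_length s == incr_pairs (weight lam s)).
Proof.
apply/idP/idP => [/forallP min_s|/eqP E]; last first.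
  apply/forallP => h; apply/implyP => /(@weight_stab s) E'.
  by rewrite E -E' incr_pairs_weight_le.
apply/negPn/negP => ne_s.
have : incr_pairs (weight lam s) < perm_length s.
  by rewrite ltn_neqAle eq_sym ne_s incr_pairs_weight_le.
rewrite perm_lengthE => lt_s.
have /fintype.subsetPn[[u v]] : ~~ ([pred p : 'I_n * 'I_n | (p.1 < p.2) &&
    ((s^-1)%g p.2 < (s^-1)%g p.1)] \subset
    [pred p : 'I_n * 'I_n | (p.1 < p.2) && (weight lam s p.1 < weight lam s p.2)]).
  by apply: contraL lt_s => /subset_leq_card; rewrite -leqNgt.
rewrite !inE /= => /andP[lt_uv lt_inv]; rewrite lt_uv /= -leqNgt => le_w.
pose h : 'S_n := (s * tperm u v * s^-1)%g.
have sh : pcomp s h = pcomp (tperm u v) s by rewrite /pcomp /h mulgKV.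
have /implyP/(_ _) := min_s h; rewrite sh leqNgt perm_length_tperm //.
move=> /(_ _)/notF; apply; apply/in_StabP => w.
rewrite !invMg invgK tpermV mulgA !permM; set x := s w.
have E : lam ((s^-1)%g u) = lam ((s^-1)%g v).
  apply/eqP; rewrite eqn_leq -!weightE le_w andbT !weightE.
  exact/lam_dom/ltnW.
by rewrite -[in RHS](permK s w) -/x; case: tpermP => [->|->|].
Qed.

(** By [min_repE] the two sets of pairs compared in [incr_pairs_weight_le] have equal cardinality,
    hence coincide. *)
Lemma weight_ltE s u v : min_rep lam s -> u < v ->
  (weight lam s u < weight lam s v) = ((s^-1)%g v < (s^-1)%g u).
Proof.
rewrite min_repE perm_lengthE => /eqP E lt_uv.
apply/idP/idP => [/weight_lt //|lt_s].
have sub : [pred p : 'I_n * 'I_n | (p.1 < p.2) &&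
      (weight lam s p.1 < weight lam s p.2)] \subset
    [pred p : 'I_n * 'I_n | (p.1 < p.2) && ((s^-1)%g p.2 < (s^-1)%g p.1)].
  by apply/fintype.subsetP => p; rewrite !inE /= => /andP[-> /weight_lt->].
have := subset_cardP (esym E) sub (u, v).
by rewrite !inE /= lt_uv lt_s.
Qed.

End MinimalRepresentatives.

(** * Covers in the Bruhat order *)

Lemma rat_frac_int (N k d : nat) : (0 < N)%N ->
  ((k%:R / N%:R * d%:R : rat) \is a Num.int) = (N %| k * d)%N.
Proof.
move=> N0; have N0' : N%:R != 0 :> rat by rewrite pnatr_eq0 -lt0n.
rewrite mulrAC -natrM; apply/idP/idP => [/intrP[z Ez]|/dvdnP[q ->]]; last first.
  by rewrite natrM mulfK.
have {}Ez : (k * d)%:R = (z * N%:Z)%:~R :> rat.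
  by rewrite intrM -Ez mulfVK.
have /intr_inj Ez' : ((k * d)%:Z)%:~R = (z * N%:Z)%:~R :> rat by rewrite -Ez.
by have := dvdz_mull z (dvdzz N%:Z); rewrite -Ez'.
Qed.

Lemma vdot_root_vec (n : nat) (f : 'rV[rat]_n) (u v : 'I_n) :
  vdot f (root_vec u v) = f 0 u - f 0 v.
Proof.
have vdot_delta w : vdot f (delta_mx 0 w) = f 0 w.
  rewrite /vdot (bigD1 w) //= big1 => [|j /negPf ne_j].
    by rewrite mxE !eqxx mulr1 addr0.
  by rewrite mxE ne_j mulr0.
rewrite -!vdot_delta /vdot -sumrB; apply: eq_bigr => j _.
by rewrite !mxE mulrBr.
Qed.

Section Covers.

Variables (n : nat) (lam : 'X_{1..n}) (N : nat).
Hypothesis lam_dom : dominant lam.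
Hypothesis N_gt0 : (0 < N)%N.
Implicit Types (s t h : 'S_n) (u v : 'I_n) (i : 'I_n.-1) (k : nat).
Local Open Scope nat_scope.

Local Notation wt := (weight lam).
Local Notation step k := (achain_step lam (k%:R / N%:R)%R).
Local Notation sp i := (pcomp (simple_perm i)).

Lemma pact_weight s u : (pact s (wvec lam) 0 u = (wt s u)%:R)%R.
Proof. by rewrite !mxE weightE. Qed.

Lemma weight_sp s i u : wt (sp i s) u = wt s (simple_perm i u).
Proof. exact: weight_tperm. Qed.

Lemma incr_pairs_weight_tperm s u v :
  incr_pairs (wt (pcomp (tperm u v) s)) = incr_pairs (fperm (wt s) (tperm u v)).
Proof. by apply: eq_incr_pairs => w; rewrite weight_tperm. Qed.

Lemma incr_pairs_weight_lt s u v : u < v -> wt s u < wt s v ->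
  incr_pairs (wt (pcomp (tperm u v) s)) < incr_pairs (wt s).
Proof. by rewrite incr_pairs_weight_tperm; apply: incr_pairs_tperm. Qed.

Lemma weight_lt_of_length s u v : min_rep lam s ->
  min_rep lam (pcomp (tperm u v) s) -> u < v ->
  perm_length (pcomp (tperm u v) s) < perm_length s -> wt s u < wt s v.
Proof.
rewrite !min_repE // => /eqP-> /eqP->; set t := pcomp _ _ => lt_uv.
rewrite ltnNge; case: ltngtP => // [lt_w|eq_w]; last first.
  rewrite /t incr_pairs_weight_tperm (@eq_incr_pairs _ _ (wt s)) ?leqnn //.
  by move=> w; rewrite /fperm; case: tpermP => // ->.
have -> : s = pcomp (tperm u v) t by rewrite /t /pcomp -mulgA tperm2 mulg1.
by rewrite ltnW // incr_pairs_weight_lt // !weight_tperm tpermL tpermR.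
Qed.

(** The inner product in [achain_step] is taken at the lower element, where it equals the positive
    difference [wt s v - wt s u]; integrality becomes divisibility by [N]. *)
Lemma achain_step_elim k s t : step k s t ->
  [/\ min_rep lam s, min_rep lam t, perm_length s = (perm_length t).+1 &
   exists u v, [/\ u < v, t = pcomp (tperm u v) s, wt s u < wt s v &
     N %| k * (wt s v - wt s u)]].
Proof.
case/and5P=> ms mt _ /eqP El /existsP[u /existsP[v /and3P[lt_uv /eqP Et]]].
have lt_w : wt s u < wt s v.
  by apply: weight_lt_of_length; rewrite -?Et // El.
rewrite vdot_root_vec !pact_weight {1 2}Et !weight_tperm tpermL tpermR.
rewrite -natrB ?(ltnW lt_w) // rat_frac_int // => dvdN.
by split => //; exists u, v.
Qed.

Lemma achain_step_intro k s u v : min_rep lam s ->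
  min_rep lam (pcomp (tperm u v) s) ->
  perm_length s = (perm_length (pcomp (tperm u v) s)).+1 -> u < v ->
  N %| k * (wt s v - wt s u) -> step k s (pcomp (tperm u v) s).
Proof.
move=> ms mt El lt_uv dvdN; set t := pcomp _ s in mt El *.
have lt_w : wt s u < wt s v.
  by apply: weight_lt_of_length => //; rewrite -/t El.
have ne_uv : u != v by rewrite -val_eqE neq_ltn lt_uv.
apply/and5P; split => //; last 2 first.
- exact/eqP.
- apply/existsP; exists u; apply/existsP; exists v; rewrite lt_uv eqxx /=.
  rewrite vdot_root_vec !pact_weight !weight_tperm tpermL tpermR.
  by rewrite -natrB ?(ltnW lt_w) // rat_frac_int.
apply/andP; split.
  by apply: contra_eq_neq El => ->; rewrite -[X in X != _]addn0 -addn1 eqn_add2l.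
apply: connect1; apply/existsP; exists u; apply/existsP; exists v.
rewrite ne_uv El ltnSn andbT; apply/eqP.
by rewrite /t /pcomp -mulgA tperm2 mulg1.
Qed.

Section SimpleReflection.

Variable i : 'I_n.-1.

Local Notation sp := (pcomp (simple_perm i)).
Local Notation lo := (simple_lo i).
Local Notation hi := (simple_hi i).

(** [pos] and [neg] single out the lower and the upper element of a two-element s_i-orbit of
    cosets. *)
Definition pos s := min_rep lam s && (wt s hi < wt s lo).
Definition neg s := min_rep lam s && (wt s lo < wt s hi).

Lemma weight_sp_lo s : wt (sp s) lo = wt s hi.
Proof. by rewrite weight_sp tpermL. Qed.

Lemma weight_sp_hi s : wt (sp s) hi = wt s lo.
Proof. by rewrite weight_sp tpermR. Qed.

Lemma incr_pairs_weight_sp s :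
  incr_pairs (wt (sp s)) = incr_pairs (fperm (wt s) (simple_perm i)).
Proof. exact: incr_pairs_weight_tperm. Qed.

Lemma perm_length_pos s : pos s -> perm_length (sp s) = (perm_length s).+1.
Proof. by case/andP=> _ /weight_lt lt_s; rewrite perm_length_simple // lt_s. Qed.

Lemma perm_length_neg s : neg s -> perm_length s = (perm_length (sp s)).+1.
Proof. by case/andP=> _ /weight_lt lt_s; rewrite -perm_length_desc // lt_s. Qed.

Lemma pos_sp s : pos s -> neg (sp s).
Proof.
move=> ps; rewrite /neg weight_sp_lo weight_sp_hi.
have lenE := perm_length_pos ps; case/andP: ps => ms lt_s; rewrite lt_s andbT.
move: ms; rewrite !min_repE // lenE incr_pairs_weight_sp.
by rewrite incr_pairs_simple_gt.
Qed.

Lemma neg_sp s : neg s -> pos (sp s).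
Proof.
move=> ns; rewrite /pos weight_sp_lo weight_sp_hi.
have lenE := perm_length_neg ns; case/andP: ns => ms lt_s; rewrite lt_s andbT.
move: ms; rewrite !min_repE // lenE incr_pairs_weight_sp.
by rewrite (incr_pairs_simple_lt lt_s).
Qed.

Lemma pos_spE s : pos (sp s) = neg s.
Proof.
by apply/idP/idP => [/pos_sp|/neg_sp //]; rewrite simple_permK.
Qed.

Lemma neg_spE s : neg (sp s) = pos s.
Proof. by rewrite -pos_spE simple_permK. Qed.

Lemma sp_tperm s u v :
  sp (pcomp (tperm u v) s)
  = pcomp (tperm (simple_perm i u) (simple_perm i v)) (sp s).
Proof.
by rewrite /pcomp -(tpermJ _ _ (simple_perm i)) /conjg !mulgA mulgK.
Qed.

Lemma ltn_simple_perm_lt u v : u < v -> (u, v) != (lo, hi) ->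
  simple_perm i u < simple_perm i v.
Proof.
move=> lt_uv ne_uv; rewrite ltn_simple_perm //.
by apply: contraTneq lt_uv => -[-> ->]; rewrite -leqNgt ltnW.
Qed.

(** Conjugation by s_i keeps the root positive: it is not the simple root, since that would give
    [t = sp s], of the opposite sign. *)
Lemma achain_step_sp k s t : step k s t ->
  (pos s && pos t) || (neg s && neg t) -> step k (sp s) (sp t).
Proof.
case/achain_step_elim => // ms mt El [u [v [lt_uv Et lt_w dvdN]]] pn.
have ne_uv : (u, v) != (lo, hi).
  apply: contraTneq pn => -[Eu Ev].
  have {}Et : t = sp s by rewrite Et Eu Ev.
  rewrite Et pos_spE neg_spE /pos /neg.
  by case: ltngtP; rewrite ?andbF.
have [ms' mt' El'] : [/\ min_rep lam (sp s), min_rep lam (sp t) &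
    perm_length (sp s) = (perm_length (sp t)).+1].
  case/orP: pn => /andP[ps pt].
    by have /andP[-> _] := pos_sp ps; have /andP[-> _] := pos_sp pt;
      rewrite !perm_length_pos // El.
  have /andP[-> _] := neg_sp ps; have /andP[-> _] := neg_sp pt.
  by split=> //; move: El; rewrite (perm_length_neg ps) (perm_length_neg pt) => -[].
rewrite Et sp_tperm; rewrite Et sp_tperm in mt' El'.
apply: achain_step_intro => //; first exact: ltn_simple_perm_lt.
by rewrite !weight_sp !simple_permKK.
Qed.

Lemma incr_pairs_weight_sp_lt s u v :
  u < v -> wt s u < wt s v -> (u, v) != (lo, hi) ->
  incr_pairs (wt (sp (pcomp (tperm u v) s))) < incr_pairs (wt (sp s)).
Proof.
move=> lt_uv lt_w ne_uv; rewrite sp_tperm; apply: incr_pairs_weight_lt.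
  exact: ltn_simple_perm_lt.
by rewrite !weight_sp !simple_permKK.
Qed.

(** For any root but the simple one, [sp t] is counted strictly below [sp s], whose count is that of
    [s] minus one, that is, the count of [t]. But s_i does not lower the count of [t] when [t] is
    not [neg]. *)
Lemma achain_step_neg k s t : step k s t -> neg s -> ~~ neg t ->
  t = sp s /\ N %| k * (wt s hi - wt s lo).
Proof.
case/achain_step_elim => // ms mt El [u [v [lt_uv Et lt_w dvdN]]] ns.
have [[Eu Ev] _|ne_uv] := eqVneq (u, v) (lo, hi).
  by rewrite Et -Eu -Ev; split => //; rewrite /simple_perm -Eu -Ev.
rewrite /neg mt /= -leqNgt => le_t.
have := incr_pairs_weight_sp_lt lt_uv lt_w ne_uv; rewrite -Et.
have lt_s : wt s lo < wt s hi by case/andP: ns.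
have := incr_pairs_simple_lt lt_s; rewrite -incr_pairs_weight_sp.
move: El ms mt; rewrite !min_repE // => El /eqP Es /eqP Etl.
move: le_t; rewrite leq_eqVlt => /orP[/eqP eq_t|lt_t].
  have := incr_pairs_simple_eq eq_t; rewrite -incr_pairs_weight_sp; lia.
have := incr_pairs_simple_gt lt_t; rewrite -incr_pairs_weight_sp; lia.
Qed.

Lemma achain_step_pos k s t : step k s t -> pos t -> ~~ pos s ->
  s = sp t /\ N %| k * (wt s hi - wt s lo).
Proof.
case/achain_step_elim => // ms mt El [u [v [lt_uv Et lt_w dvdN]]] pt.
have [[Eu Ev] _|ne_uv] := eqVneq (u, v) (lo, hi).
  split; last by rewrite -Eu -Ev.
  by rewrite Et Eu Ev -[LHS](simple_permK i).
rewrite /pos ms /= -leqNgt => le_s.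
have := incr_pairs_weight_sp_lt lt_uv lt_w ne_uv; rewrite -Et.
have lt_t : wt t hi < wt t lo by case/andP: pt.
have := incr_pairs_simple_gt lt_t; rewrite -incr_pairs_weight_sp.
move: El ms mt; rewrite !min_repE // => El /eqP Es /eqP Etl.
move: le_s; rewrite leq_eqVlt => /orP[/eqP eq_s|lt_s].
  have := incr_pairs_simple_eq (esym eq_s); rewrite -incr_pairs_weight_sp; lia.
have := incr_pairs_simple_lt lt_s; rewrite -incr_pairs_weight_sp; lia.
Qed.

End SimpleReflection.
End Covers.

(** * Chains and simple reflections *)

Lemma connect_ind_l (T : finType) (e : rel T) (y : T) (P : T -> Prop) :
  P y -> (forall x x', e x x' -> connect e x' y -> P x' -> P x) ->
  forall x, connect e x y -> P x.
Proof.
move=> Py Pe x /connectP[p ep Ey].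
elim: p x ep Ey => [|x' p IHp] x /= => [_ <- //|/andP[exx' ep] Ey].
by apply: Pe exx' _ (IHp _ ep Ey); apply/connectP; exists p.
Qed.

Section Chains.

Variables (n : nat) (lam : 'X_{1..n}) (N : nat).
Hypothesis lam_dom : dominant lam.
Hypothesis N_gt0 : (0 < N)%N.
Implicit Types (s t x y p q : 'S_n) (u v : 'I_n) (k : nat).
Local Open Scope nat_scope.

Local Notation wt := (weight lam).
Local Notation step k := (achain_step lam (k%:R / N%:R)%R).

(** The relation is reflexive; [chain k s s] will stand for not turning at time k / N. *)
Definition chain k : rel 'S_n := connect (step k).

Lemma chain_trans k s t x : chain k s t -> chain k t x -> chain k s x.
Proof. exact: connect_trans. Qed.

Lemma step_chain k s t : step k s t -> chain k s t.
Proof. exact: connect1. Qed.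

Lemma chain_min_rep k s t : chain k s t -> min_rep lam s -> min_rep lam t.
Proof.
move: s; apply: connect_ind_l => // s s' st _ IH _; apply: IH.
by case/achain_step_elim: st.
Qed.

Lemma chain_weight k s t : chain k s t ->
  forall u, k * wt s u = k * wt t u %[mod N].
Proof.
move: s; apply: connect_ind_l => // s s' st _ IH u; rewrite -{}IH.
case/achain_step_elim: st => // _ _ _ [a [b [_ -> lt_w dvdN]]].
have E : k * wt s a = k * wt s b %[mod N].
  apply/eqP; rewrite eq_sym eqn_mod_dvd -?mulnBr //.
  by rewrite leq_mul2l (ltnW lt_w) orbT.
by rewrite weight_tperm; case: tpermP => [->|->|].
Qed.

Section SimpleReflection.

Variable i : 'I_n.-1.

Local Notation sp := (pcomp (simple_perm i)).
Local Notation lo := (simple_lo i).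
Local Notation hi := (simple_hi i).
Local Notation pos := (pos lam i).
Local Notation neg := (neg lam i).

Definition integral k s := k * wt s lo == k * wt s hi %[mod N].

Lemma chain_integral k s t : chain k s t -> integral k s = integral k t.
Proof. by move/chain_weight => H; rewrite /integral !H. Qed.

Lemma integral_sp k s : integral k (sp s) = integral k s.
Proof. by rewrite /integral weight_sp_lo weight_sp_hi eq_sym. Qed.

Lemma integral_dvd k s : wt s hi <= wt s lo ->
  integral k s = (N %| k * (wt s lo - wt s hi)).
Proof.
by move=> le_s; rewrite mulnBr /integral eqn_mod_dvd // leq_mul2l le_s orbT.
Qed.

Lemma integral_zero k s : min_rep lam s -> ~~ pos s -> ~~ neg s -> integral k s.
Proof.
rewrite /pos /neg => -> /=; rewrite -!leqNgt => le1 le2.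
by rewrite /integral; have -> : wt s lo = wt s hi by apply/eqP; rewrite eqn_leq le1.
Qed.

Lemma pos_negF x : pos x -> ~~ neg x.
Proof. by rewrite /pos /neg; case: ltngtP; rewrite ?andbF. Qed.

Lemma chain_sp k s : pos s -> integral k s -> chain k (sp s) s.
Proof.
move=> ps int_s; apply: step_chain.
have /andP[ms lt_s] := ps; have /andP[ms' _] := pos_sp lam_dom ps.
have Es : s = sp (sp s) by rewrite simple_permK.
rewrite [X in step k _ X]Es; apply: achain_step_intro => //.
- by rewrite -Es.
- by rewrite -Es (perm_length_pos lam_dom ps).
- by rewrite weight_sp_lo weight_sp_hi -integral_dvd // ltnW.
Qed.

(** The chain leaves [neg] through a step that is s_i itself. Applying s_i to the part before that
    step and deleting the step gives a chain from [sp x]. *)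
Lemma chain_neg k x y : chain k x y -> neg x -> ~~ neg y ->
  integral k x /\ chain k (sp x) y.
Proof.
move: x; apply: connect_ind_l => [->//|x x' xx' x'y IH nx ny].
have [nx'|nx'] := boolP (neg x').
  have [int_x' chx'] := IH nx' ny; split.
    by rewrite (chain_integral (step_chain xx')).
  apply: chain_trans chx'; apply: step_chain.
  by apply: achain_step_sp => //; rewrite nx nx' orbT.
have [Ex' dvdN] := achain_step_neg lam_dom N_gt0 xx' nx nx'.
rewrite -Ex'; split=> //; rewrite -integral_sp integral_dvd.
  by rewrite weight_sp_lo weight_sp_hi.
by rewrite weight_sp_lo weight_sp_hi ltnW //; case/andP: nx.
Qed.

(** Going up from [y], the part of the chain inside [pos] is reflected by s_i. A step from outside
    into [pos] is s_i itself and is dropped; where the chain leaves [pos], integrality allows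
    inserting the step from [sp x] to [x]. *)
Lemma chain_to_pos k x y : chain k x y -> pos y -> integral k y ->
  (~~ pos x -> chain k x (sp y)) /\ (pos x -> chain k (sp x) (sp y)).
Proof.
move=> chxy py int_y; move: x chxy; apply: connect_ind_l => [|x x' xx' x'y [IH1 IH2]].
  by rewrite py; split=> // _; apply: connect0.
have [px'|px'] := boolP (pos x'); split => px.
- by have [-> _] := achain_step_pos lam_dom N_gt0 xx' px' px; apply: IH2.
- apply: chain_trans (IH2 px'); apply: step_chain.
  by apply: achain_step_sp => //; rewrite px px'.
- exact: chain_trans (step_chain xx') (IH1 px').
- apply: chain_trans (IH1 px'); apply: chain_trans (step_chain xx').
  by apply: chain_sp => //; rewrite (chain_integral (chain_trans (step_chain xx') x'y)).
Qed.

Lemma chain_sp_pos k x y : pos x -> pos y -> chain k x y -> chain k (sp x) (sp y).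
Proof.
move=> px py chxy; have [int_y|nint_y] := boolP (integral k y).
  by have [_] := chain_to_pos chxy py int_y; apply.
move: x chxy px; apply: connect_ind_l => [_|x x' xx' x'y IH px].
  exact: connect0.
have nint_x' : ~~ integral k x' by rewrite (chain_integral x'y).
have px' : pos x'.
  have mx' : min_rep lam x' by case/achain_step_elim: xx'.
  (* Without integrality the chain stays in [pos]: passing from [neg] to [y] forces integrality, and
     a one-element orbit is integral. *)
  apply: contraNT nint_x' => px'; have [nx'|nx'] := boolP (neg x').
    by have [] := chain_neg x'y nx' (pos_negF py).
  exact: integral_zero.
apply: chain_trans (IH px'); apply: step_chain.
by apply: achain_step_sp => //; rewrite px px'.
Qed.

Lemma chain_sp_neg k x y : neg x -> neg y -> chain k x y -> chain k (sp x) (sp y).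
Proof.
move=> nx ny chxy; have [int_y|nint_y] := boolP (integral k y).
  (* Prolonging the chain from [y] to [sp y] brings it under [chain_neg]. *)
  have py : pos (sp y) by rewrite neg_sp.
  have chy : chain k y (sp y).
    by rewrite -{1}(simple_permK i y) chain_sp // integral_sp.
  by have [] := chain_neg (chain_trans chxy chy) nx (pos_negF py).
move: x chxy nx; apply: connect_ind_l => [_|x x' xx' x'y IH nx].
  exact: connect0.
have nx' : neg x'.
  apply: contraNT nint_y => nx'.
  have [int_x _] := chain_neg (step_chain xx') nx nx'.
  by rewrite -(chain_integral (chain_trans (step_chain xx') x'y)).
apply: chain_trans (IH nx'); apply: step_chain.
by apply: achain_step_sp => //; rewrite nx nx' orbT.
Qed.

Lemma chain_spsp k p q : pos p -> pos q -> chain k (sp p) (sp q) = chain k p q.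
Proof.
move=> pp pq; apply/idP/idP => [|/chain_sp_pos->//].
by move/chain_sp_neg; rewrite !simple_permK; apply; apply: pos_sp.
Qed.

Lemma chain_spl k p q : pos p -> ~~ neg q ->
  chain k (sp p) q = integral k p && chain k p q.
Proof.
move=> pp nq; apply/idP/andP => [chpq|[int_p chpq]].
  have [] := chain_neg chpq (pos_sp lam_dom pp) nq.
  by rewrite integral_sp simple_permK.
exact: chain_trans (chain_sp pp int_p) chpq.
Qed.

Lemma chain_zero_pos k p q : min_rep lam p -> ~~ pos p -> ~~ neg p -> pos q ->
  chain k p (sp q) = chain k p q.
Proof.
move=> mp pp np pq; have int_p := integral_zero k mp pp np.
apply/idP/idP => [chpq|chpq].
  apply: (chain_trans (chpq)); apply: chain_sp => //.
  by move/chain_integral: chpq; rewrite integral_sp => <-.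
by have [|->//] := chain_to_pos chpq pq; rewrite -(chain_integral chpq).
Qed.

End SimpleReflection.
End Chains.

(** * The string relation *)

Section StringRelation.

Variables (n N : nat) (i : 'I_n.-1).
Hypothesis N_gt0 : (0 < N)%N.
Implicit Types (f g h : {mpoly int[n]}) (r : nat).

Local Notation lo := (simple_lo i).
Local Notation hi := (simple_hi i).
Local Notation Y := ('X_lo : {mpoly int[n]}).
Local Notation Z := ('X_hi : {mpoly int[n]}).
Local Notation sw := (msym (simple_perm i)).

(* The relation [(z - 1) g = z ^ phi f - s f] of the header, with [phi = r / N],
   multiplied by [Z ^+ N] to clear denominators: [z = (Y / Z) ^+ N]. *)
Definition string_rel r f g : Prop :=
  (Y ^+ N - Z ^+ N) * g = Y ^+ r * Z ^+ (N - r) * f - Z ^+ N * sw f.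

Lemma msym_simpleK : involutive (sw : {mpoly int[n]} -> _).
Proof. by move=> f; rewrite -msymMm tperm2 msym1m. Qed.

Lemma msym_X (s : 'S_n) (j : 'I_n) : msym s 'X_j = 'X_(s j) :> {mpoly int[n]}.
Proof. by rewrite /msym mmapX mmap1U. Qed.

Lemma sw_Y : sw Y = Z. Proof. by rewrite msym_X tpermL. Qed.
Lemma sw_Z : sw Z = Y. Proof. by rewrite msym_X tpermR. Qed.

Lemma mpolyX_simple_expr_neq : Y ^+ N - Z ^+ N != 0.
Proof.
rewrite subr_eq0 !mpolyXn; apply/eqP => /(congr1 (mcoeff (U_(lo) *+ N))).
rewrite !mcoeffX eqxx; case: eqP => // /(congr1 (fun m : 'X_{1..n} => m lo)).
rewrite !mulmnE !mnm1E eqxx -val_eqE /= gtn_eqF // mul0n mul1n => E.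
by move: N_gt0; rewrite -E.
Qed.

Lemma string_rel_sw r f g : string_rel r f g ->
  (Z ^+ N - Y ^+ N) * sw g = Z ^+ r * Y ^+ (N - r) * sw f - Y ^+ N * f.
Proof.
move/(congr1 sw); rewrite !(rmorphM, rmorphB, rmorphXn) /= !sw_Y !sw_Z.
by rewrite msym_simpleK.
Qed.

Lemma string_rel0 r : string_rel r 0 0.
Proof. by rewrite /string_rel raddf0 !mulr0 subr0. Qed.

Lemma string_relD r f g f' g' : string_rel r f g -> string_rel r f' g' ->
  string_rel r (f + f') (g + g').
Proof. by rewrite /string_rel raddfD !mulrDr => -> ->; ring. Qed.

Lemma string_rel_sum (I : Type) (l : seq I) (P : pred I) r
    (F G : I -> {mpoly int[n]}) :
  (forall j, P j -> string_rel r (F j) (G j)) ->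
  string_rel r (\sum_(j <- l | P j) F j) (\sum_(j <- l | P j) G j).
Proof.
move=> H; elim/big_ind2: _ => // [|f g f' g']; first exact: string_rel0.
exact: string_relD.
Qed.

Lemma string_rel_shift f g : string_rel 0 f g -> string_rel N f (f + g).
Proof.
rewrite /string_rel subnn subn0 !expr0 mul1r mulr1 mulrDr => ->.
by ring.
Qed.

(** The product of [f + g] by the antisymmetric [Y ^+ N - Z ^+ N] is [Y ^+ N * f - Z ^+ N * sw f],
    again antisymmetric. *)
Lemma string_rel_sym f g : string_rel 0 f g -> sw (f + g) = f + g.
Proof.
move=> H; apply: (mulfI mpolyX_simple_expr_neq).
have := string_rel_sw H; move: H; rewrite /string_rel subn0 !expr0 !mul1r.
move=> H1 H2; rewrite raddfD /= !mulrDr H1.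
have -> : (Y ^+ N - Z ^+ N) * sw g = - ((Z ^+ N - Y ^+ N) * sw g) by ring.
by rewrite H2; ring.
Qed.

Lemma string_rel_diag h : sw h = h -> string_rel N h h.
Proof. by rewrite /string_rel => ->; rewrite subnn expr0 mulr1 mulrBl. Qed.

(** The conclusion says z ^ phi g = s g. Multiplying the hypothesis by z ^ phi, and its image under
    s by -z, gives the same right-hand side z f - z ^ phi s f. *)
Lemma string_rel_opp r f g : (r <= N)%N ->
  string_rel (N - r) f g -> string_rel r g 0.
Proof.
move=> le_r H; have := string_rel_sw H; move: H.
rewrite /string_rel subKn // mulr0 => H1 H2.
have EY : Y ^+ N = Y ^+ r * Y ^+ (N - r) by rewrite -exprD subnKC.
have EZ : Z ^+ N = Z ^+ r * Z ^+ (N - r) by rewrite -exprD subnKC.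
apply: (mulfI mpolyX_simple_expr_neq); rewrite mulr0 mulrBr.
rewrite [X in X - _]mulrCA H1.
have -> : (Y ^+ N - Z ^+ N) * (Z ^+ N * sw g)
  = - Z ^+ N * ((Z ^+ N - Y ^+ N) * sw g) by ring.
by rewrite H2 EY EZ; ring.
Qed.

(** The two monomials differ by the factor (Z / Y) ^ d, which lowers the exponent [r] by [d]. *)
Lemma string_rel_mul r f g (m : 'X_{1..n}) : (m hi <= m lo)%N ->
  (m lo - m hi <= r)%N -> (r <= N)%N -> string_rel r f g ->
  string_rel (r - (m lo - m hi)) ('X_[m] * f)
    ('X_[[multinom m (simple_perm i j) | j < n]] * g).
Proof.
set d := (m lo - m hi)%N => le_m le_d le_r.
set m' := [multinom _ | _ < _].
have sm : sw 'X_[m] = 'X_[m'] :> {mpoly int[n]}.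
  by rewrite msymX tpermV; congr 'X_[_]; apply/mnmP => j; rewrite !mnmE.
have E : Y ^+ d * 'X_[m'] = Z ^+ d * 'X_[m].
  rewrite !mpolyXn -!mpolyXD; congr 'X_[_]; apply/mnmP => j.
  have lo_hi : (lo == hi) = false by rewrite -val_eqE /= ltn_eqF.
  rewrite !mnmDE !mulmnE !mnm1E mnmE /simple_perm.
  case: tpermP => [->|->|/eqP ne1 /eqP ne2].
  - by rewrite eqxx [hi == _]eq_sym lo_hi /d; lia.
  - by rewrite eqxx lo_hi /d; lia.
  - by rewrite ![_ == j]eq_sym (negPf ne1) (negPf ne2).
rewrite /string_rel msymM sm => H.
rewrite mulrCA H.
have -> : Y ^+ r = Y ^+ (r - d) * Y ^+ d by rewrite -exprD subnK.
have -> : (N - (r - d))%N = (N - r + d)%N by lia.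
rewrite exprD mulrBr.
have -> : 'X_[m'] * (Y ^+ (r - d) * Y ^+ d * Z ^+ (N - r) * f)
  = Y ^+ (r - d) * Z ^+ (N - r) * f * (Y ^+ d * 'X_[m']) by ring.
by rewrite E; ring.
Qed.

End StringRelation.

(** * The transfer matrix recursion *)

Section Tails.

Variables (n : nat) (lam : 'X_{1..n}) (N : nat).
Hypothesis lam_dom : dominant lam.
Hypothesis N_gt0 : (0 < N)%N.
Hypothesis lam_dvdN : forall u v, (lam v < lam u)%N -> (lam u - lam v %| N)%N.
Implicit Types (s t : 'S_n) (j k : nat) (p q : seq ('S_n * nat)).

Local Notation wt := (weight lam).
Local Notation chain := (chain lam N).

(* A list [(tau_1, k_1); ...; (tau_r, k_r)] encodes the final piece of a path that
   has direction [tau_l] until time [k_l / N].  The pieces in [tails j s] start at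
   time [(N - j) / N] in the direction [s]; the starting time is not recorded,
   so [tails j s] is also the list of those pieces in [tails j.+1 s] that do not turn
   at time [(N - j) / N]. *)
Fixpoint tails j s : seq (seq ('S_n * nat)) :=
  if j is j'.+1 then
    (if j' == 0%N then [:: [:: (s, N)]] else
     [seq (s, N - j')%N :: p
        | t <- [seq t <- enum {: 'S_n} | (t != s) && chain (N - j') s t],
          p <- tails j' t])
    ++ tails j' s
  else [::].

Definition tail_rel : rel ('S_n * nat) := fun x y =>
  [&& (x.2 < y.2)%N, y.1 != x.1 & chain x.2 x.1 y.1].

Definition is_tail k s p : bool :=
  if p is (t, l) :: q then
    [&& t == s, (k < l)%N, path tail_rel (s, l) q & (last (s, l) q).2 == N]
  else false.

Lemma tail_path_le x p : path tail_rel x p -> (x.2 <= (last x p).2)%N.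
Proof.
elim: p x => //= y p IHp x /andP[/and3P[lt_xy _ _] /IHp].
exact: leq_trans (ltnW lt_xy).
Qed.

Lemma tailsP j s p : (j <= N)%N -> (p \in tails j s) = is_tail (N - j) s p.
Proof.
elim: j s p => [|j IHj] s p le_j.
  rewrite in_nil; case: p => [|[t l] q] //=; apply/esym/negbTE.
  apply/negP => /and4P[_ lt_l /tail_path_le /= le_l /eqP E].
  by move: le_l; rewrite E; lia.
have lt_j : (N - j.+1 < N - j)%N by lia.
(* The first direction of a piece starting at (N - j - 1) / N ends either after time (N - j) / N or
   exactly then. *)
have is_tailS : is_tail (N - j.+1) s p = is_tail (N - j) s p ||
    (if p is (t, l) :: q then
      [&& t == s, l == N - j, path tail_rel (s, l) q & (last (s, l) q).2 == N]%N
     else false).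
  case: p => [|[t l] q] //=; case: (t == s) => //=; rewrite -andb_orl.
  by congr (_ && _); lia.
rewrite /= mem_cat IHj 1?ltnW // is_tailS orbC; congr (_ || _).
case: ifP => [/eqP j0|/negbT j_neq0].
  rewrite j0 subn0 inE; case: p {is_tailS} => [|[t l] q] //=.
  rewrite eqseq_cons xpair_eqE -andbA; apply: andb_id2l => _.
  apply: andb_id2l => /eqP->; case: q => [|[u m] q] /=; first by rewrite !eqxx.
  transitivity false => //; apply/esym/negbTE/negP.
  case/andP=> /andP[/and3P[/= lt_m _ _] /tail_path_le /= le_m] /eqP E.
  by move: le_m; rewrite E leqNgt lt_m.
apply/allpairsPdep/idP => [[t [q []]]|].
  rewrite mem_filter => /andP[/andP[ne_t ch] _]; rewrite IHj 1?ltnW // => tq ->.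
  rewrite !eqxx /=; case: q tq => [|[u m] q] //= /and4P[/eqP-> lt_m pq lq].
  by rewrite pq lq /tail_rel /= lt_m ne_t ch.
case: p {is_tailS} => [|[t l] q] // /and4P[/eqP-> /eqP-> pq lq].
case: q pq lq => [_ /= /eqP E|[u m] q /= /andP[/and3P[/= lt_m ne_u ch] pq] lq].
  by move: j_neq0; lia.
exists u, ((u, m) :: q); split => //; first by rewrite mem_filter ne_u ch mem_enum.
by rewrite IHj 1?ltnW //= eqxx lt_m pq.
Qed.

Lemma tails_uniq j s : (j <= N)%N -> uniq (tails j s).
Proof.
elim: j s => // j IHj s le_j /=; rewrite cat_uniq IHj 1?ltnW // andbT.
apply/andP; split.
  case: ifP => // _; apply: allpairs_uniq_dep.
  - by rewrite filter_uniq ?enum_uniq.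
  - by move=> t _; rewrite IHj // ltnW.
  (* The new direction [t] is recovered as the first entry of [q]. *)
  move=> x y /allpairsPdep[t [q [_ tq ->]]] /allpairsPdep[t' [q' [_ tq' ->]]] /=.
  move: tq tq'; rewrite !tailsP 1?ltnW // => tq tq' [Eq].
  move: tq tq'; rewrite Eq; case: q' {Eq} => [|[u m] q'] //=.
  by move=> /and4P[/eqP-> _ _ _] /and4P[/eqP-> _ _ _].
apply/hasPn => p; rewrite tailsP 1?ltnW //; case: p => [|[t l] q] // /and4P[_ lt_l _ _].
case: ifP => [/eqP j0|_].
  rewrite j0 subn0 in lt_l; rewrite inE.
  by apply: contraTneq lt_l => -[_ -> _]; rewrite ltnn.
by apply: contraL lt_l => /allpairsPdep[u [q' [_ _ [_ -> _]]]]; rewrite ltnn.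
Qed.

(** This is [N] times the displacement along the piece from time k / N on, hence its exponent in the
    variables y_j. *)
Fixpoint tail_weight k p : 'X_{1..n} :=
  if p is (s, l) :: q then (wt s *+ (l - k) + tail_weight l q)%MM else 0%MM.

Definition tail_sum j s : {mpoly int[n]} :=
  \sum_(p <- tails j s) 'X_[tail_weight (N - j) p].

(** This is [tail_sum] with the transition at time (N - j) / N applied. At time 1 there is no
    transition, and the value 1 starts the recursion. *)
Definition chain_sum j s : {mpoly int[n]} :=
  if j == 0%N then 1 else \sum_(t | chain (N - j) s t) tail_sum j t.

Lemma tail_sum0 s : tail_sum 0 s = 0.
Proof. by rewrite /tail_sum big_nil. Qed.

Lemma tail_sumS j s : (j < N)%N ->
  tail_sum j.+1 s = 'X_[wt s] * chain_sum j s.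
Proof.
move=> lt_j; have NjS : (N - j - (N - j.+1) = 1)%N by lia.
rewrite /tail_sum /= big_cat /=.
have -> : \sum_(p <- tails j s) 'X_[tail_weight (N - j.+1) p]
    = 'X_[wt s] * tail_sum j s :> {mpoly int[n]}.
  rewrite /tail_sum mulr_sumr !big_seq; apply: eq_bigr => p.
  rewrite tailsP 1?ltnW //; case: p => [|[t l] q] // /and4P[/eqP-> lt_l _ _] /=.
  rewrite -mpolyXD; congr 'X_[_]; rewrite addmA; congr (_ + _)%MM.
  by rewrite -mulmS; congr (_ *+ _)%MM; lia.
rewrite /chain_sum; case: ifP => [/eqP j0|j_neq0].
  rewrite j0 big_seq1 tail_sum0 mulr0 addr0 mulr1 /=.
  by congr 'X_[_]; rewrite -j0 -[N in (N - _)%N]subn0 -j0 NjS mulm1n addm0.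
(* The term [t = s] collects the pieces that do not turn at this time. *)
rewrite (bigD1 s) /=; last exact: connect0.
rewrite mulrDr addrC; congr (_ + _).
rewrite big_allpairs_dep big_filter mulr_sumr big_enum_cond /=.
apply: eq_big => [t|t _]; first by rewrite andbC.
rewrite mulr_sumr; apply: eq_bigr => p _ /=.
by rewrite NjS mulm1n -mpolyXD.
Qed.


Lemma weight_dvdN s u v : (wt s v < wt s u)%N -> (wt s u - wt s v %| N)%N.
Proof. by rewrite !weightE; apply: lam_dvdN. Qed.

Section SimpleReflection.

Variable i : 'I_n.-1.

Local Notation sp := (pcomp (simple_perm i)).
Local Notation lo := (simple_lo i).
Local Notation hi := (simple_hi i).
Local Notation pos := (pos lam i).
Local Notation neg := (neg lam i).
Local Notation sw := (msym (simple_perm i)).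
Local Notation integral := (integral lam N i).
Local Notation string_rel := (string_rel N i).

Definition zero s := [&& min_rep lam s, ~~ pos s & ~~ neg s].

Definition height s : nat := (wt s lo - wt s hi)%N.

Lemma chain_sum_split k s (G : 'S_n -> {mpoly int[n]}) : min_rep lam s ->
  \sum_(t | chain k s t) G t
  = \sum_(t | pos t) ((if chain k s t then G t else 0)
                      + (if chain k s (sp t) then G (sp t) else 0))
    + \sum_(t | zero t) (if chain k s t then G t else 0).
Proof.
move=> ms; rewrite big_mkcond (bigID pos) /= big_split -addrA; congr (_ + _).
rewrite (bigID neg) /=; congr (_ + _).
  have sp_inj : injective sp by exact: (can_inj (simple_permK i)).
  rewrite (reindex_inj sp_inj); apply: eq_bigl => t.
  rewrite pos_spE // neg_spE // andbC; apply: andb_idr.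
  exact: pos_negF.
rewrite [RHS]big_mkcond [LHS]big_mkcond; apply: eq_bigr => t _.
rewrite /zero; have [//|mt /=] := boolP (min_rep lam t).
have -> : chain k s t = false by apply: contraNF mt => /chain_min_rep; apply.
by rewrite if_same.
Qed.

(* [N] times the fractional part [phi] just after the transition at time [k / N]
   has been applied, whence the value [N] rather than [0] at integral points. *)
Definition phase k s : nat :=
  if integral k s then N else (k * height s %% N)%N.

Lemma phase_eq k s t : pos s -> pos t -> chain k s t -> phase k s = phase k t.
Proof.
move=> ps pt ch; rewrite /phase (chain_integral lam_dom N_gt0 i ch); case: ifP => // _.
case/andP: ps => _ lt_s; case/andP: pt => _ lt_t.
apply/eqP; rewrite -(eqn_modDr (k * wt s hi)) /height -mulnDr subnK ?(ltnW lt_s) //.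
rewrite (chain_weight lam_dom N_gt0 ch lo) eq_sym -modnDmr.
rewrite (chain_weight lam_dom N_gt0 ch hi) modnDmr.
by rewrite -mulnDr subnK ?(ltnW lt_t).
Qed.

(** Passing to [sp t] negates the height, so the two residues, both nonzero, add up to [N]. *)
Lemma phase_opp k s t : pos s -> pos t -> chain k s (sp t) ->
  ~~ integral k s -> (phase k t = N - phase k s)%N.
Proof.
move=> ps pt ch nint_s.
have nint_t : ~~ integral k t.
  by rewrite -(integral_sp lam N i) -(chain_integral lam_dom N_gt0 i ch).
rewrite /phase (negPf nint_s) (negPf nint_t).
have /andP[_ lt_s] := ps; have /andP[_ lt_t] := pt.
have : (k * height s + k * height t = 0 %[mod N])%N.
  apply/eqP; rewrite -(eqn_modDr (k * wt s hi + k * wt t hi)) addnACA -!mulnDr.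
  rewrite /height !subnK ?(ltnW lt_s) ?(ltnW lt_t) // add0n.
  rewrite !mulnDr -modnDml (chain_weight lam_dom N_gt0 ch lo) weight_sp_lo modnDml.
  rewrite -[X in _ == X]modnDml (chain_weight lam_dom N_gt0 ch hi).
  by rewrite weight_sp_hi modnDml addnC.
have := nint_s; rewrite integral_dvd ?(ltnW lt_s) // -/(height s) /dvdn.
rewrite mod0n -modnDm.
move: (ltn_pmod (k * height s) N_gt0) (ltn_pmod (k * height t) N_gt0).
move: (_ %% N)%N (k * height t %% N)%N => a b lt_a lt_b a0 /eqP.
rewrite -/(dvdn N _) => /dvdnP[[|[|c]]]; lia.
Qed.

Lemma phase_le k s : (phase k s <= N)%N.
Proof. by rewrite /phase; case: ifP => // _; apply/ltnW/ltn_pmod. Qed.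

(** Since the height divides [N], the phase is a positive multiple of it. One unit of time backwards
    thus subtracts the height without wrapping around modulo [N]. *)
Lemma phase_height k s : pos s -> (0 < k)%N ->
  (height s <= phase k s)%N /\
  (phase k s - height s = (k.-1 * height s) %% N)%N.
Proof.
case/andP=> _ lt_s; case: k => // k _ /=.
have h_gt0 : (0 < height s)%N by rewrite subn_gt0.
have hN : (height s %| N)%N by apply: weight_dvdN.
have [m Em] : exists m, phase k.+1 s = (m * height s)%N.
  apply/dvdnP; rewrite /phase; case: ifP => // _.
  by rewrite /dvdn modn_dvdm // -/(dvdn _ _) dvdn_mull.
have ph_gt0 : (0 < phase k.+1 s)%N.
  rewrite /phase; case: ifP => // /negbT.
  by rewrite integral_dvd ?(ltnW lt_s) // /dvdn lt0n.
have le_h : (height s <= phase k.+1 s)%N.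
  by apply: dvdn_leq ph_gt0 _; rewrite Em dvdn_mull.
split => //.
have E : (phase k.+1 s = k.+1 * height s %[mod N])%N.
  rewrite /phase; case: ifP => [|_]; last by rewrite modn_mod.
  by rewrite integral_dvd ?(ltnW lt_s) // modnn => /eqP.
have : (phase k.+1 s - height s = k * height s %[mod N])%N.
  by apply/eqP; rewrite -(eqn_modDr (height s)) subnK // E mulSn addnC.
by move=> <-; rewrite modn_small // ltn_subLR //; have := phase_le k.+1 s; lia.
Qed.

Lemma string_rel_block k s t f g : pos s -> pos t ->
  string_rel (k * height t %% N) f g ->
  string_rel (phase k s)
    ((if chain k s t then f else 0) + (if chain k s (sp t) then g else 0))
    ((if chain k (sp s) t then f else 0) + (if chain k (sp s) (sp t) then g else 0)).
Proof.
move=> ps pt fg; rewrite chain_spsp // chain_spl ?pos_negF //.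
have [int_s|nint_s] /= := boolP (integral k s).
  have phs : phase k s = N by rewrite /phase int_s.
  have int_of x : chain k s x -> integral k x.
    by move/(chain_integral lam_dom N_gt0 i) <-.
  have fg0 : integral k t -> string_rel 0 f g.
    have /andP[_ lt_t] := pt; rewrite integral_dvd ?(ltnW lt_t) // => /eqP E.
    by move: fg; rewrite E.
  (* In the integral case an entry from [s] to [sp t] makes all four entries one, and both sums
     equal the symmetric [f + g]. Otherwise the sums are [f] and [f + g], or vanish. *)
  rewrite phs; have [ch2|_] := boolP (chain k s (sp t)).
    have int_t : integral k t by rewrite -(integral_sp lam N i) int_of.
    have -> : chain k s t by apply: chain_trans ch2 (chain_sp _ _ _ _).
    exact/string_rel_diag/(string_rel_sym N_gt0)/fg0.
  case: ifP => [/int_of/fg0 H|_]; last by rewrite !addr0; apply: string_rel0.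
  by rewrite addr0; apply: string_rel_shift.
(* In the other case the equal diagonal entries and the entry from [s] to [sp t] are treated
   separately; the latter adds [g] to the first sum only. *)
rewrite add0r.
have string0 r : string_rel r 0 0 by apply: string_rel0.
rewrite -[X in string_rel _ _ X]add0r.
rewrite [X in string_rel _ _ X]addrC; apply: string_relD; case: ifP => // ch.
  rewrite (phase_eq ps pt ch) /phase ifN //.
  by rewrite -(chain_integral lam_dom N_gt0 i ch).
apply: (@string_rel_opp n N i N_gt0 _ f _ (phase_le _ _)).
rewrite -(phase_opp ps pt ch nint_s) /phase ifN //.
by rewrite -(integral_sp lam N i) -(chain_integral lam_dom N_gt0 i ch).
Qed.

Definition tail_sum_strings j : Prop :=
  (forall s, pos s ->
     string_rel ((N - j) * height s %% N) (tail_sum j s) (tail_sum j (sp s)))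
  /\ (forall s, zero s -> sw (tail_sum j s) = tail_sum j s).

Definition chain_sum_strings j : Prop :=
  (forall s, pos s ->
     string_rel (phase (N - j) s) (chain_sum j s) (chain_sum j (sp s)))
  /\ (forall s, zero s -> sw (chain_sum j s) = chain_sum j s).

Lemma tail_sum_stringsS j : (j < N)%N ->
  chain_sum_strings j -> tail_sum_strings j.+1.
Proof.
move=> lt_j [IHp IHz]; split=> s hs; rewrite !tail_sumS //.
  have [|le_h <-] := @phase_height (N - j.+1).+1 s hs; first by [].
  rewrite subnSK // in le_h *.
  have -> : wt (sp s) = [multinom wt s (simple_perm i u) | u < n].
    by apply/mnmP => u; rewrite weight_sp mnmE.
  apply: string_rel_mul => //; first by case/andP: hs => _ /ltnW.
    exact: phase_le.
  exact: IHp.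
rewrite msymM IHz // msymX tpermV; congr ('X_[_] * _); apply/mnmP => u.
case/and3P: hs => ms; rewrite /pos /neg ms /= -!leqNgt => le1 le2.
have eq_w : wt s lo = wt s hi by apply/eqP; rewrite eqn_leq le1.
by rewrite mnmE; case: tpermP => [->|->|].
Qed.

Lemma chain_sum_strings0 : chain_sum_strings 0.
Proof.
have sw1 : sw 1 = 1 :> {mpoly int[n]} by rewrite msym1.
split=> s; rewrite /chain_sum //= => ps; rewrite subn0.
have -> : phase N s = N.
  have /andP[_ lt_s] := ps.
  by rewrite /phase integral_dvd ?(ltnW lt_s) // dvdn_mulr.
exact: string_rel_diag.
Qed.

Lemma chain_sum_stringsS j :
  tail_sum_strings j.+1 -> chain_sum_strings j.+1.
Proof.
case=> IHp IHz; split=> s hs; rewrite /chain_sum /=.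
  have /andP[ms _] := hs; have /andP[ms' _] := pos_sp lam_dom hs.
  rewrite !chain_sum_split //; apply: string_relD.
    by apply: string_rel_sum => t pt; apply: string_rel_block => //; apply: IHp.
  apply: string_rel_sum => t zt; have /and3P[mt pt nt] := zt.
  rewrite chain_spl //; case: ifP => [ch|_]; last by rewrite andbF; apply: string_rel0.
  have int_s : integral (N - j.+1) s.
    by rewrite (chain_integral lam_dom N_gt0 i ch) integral_zero.
  by rewrite int_s /phase int_s; apply/string_rel_diag/IHz.
have /and3P[ms ps ns] := hs.
rewrite chain_sum_split // raddfD !raddf_sum /=; congr (_ + _).
  apply: eq_bigr => t pt; rewrite (chain_zero_pos _ _ _ ms) //.
  case: ifP => [ch|_]; last by rewrite addr0 raddf0.
  apply: (string_rel_sym N_gt0).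
  have : integral (N - j.+1) t.
    by rewrite -(chain_integral lam_dom N_gt0 i ch) integral_zero.
  have /andP[_ lt_t] := pt; rewrite integral_dvd ?(ltnW lt_t) // => /eqP E.
  by have := IHp t pt; rewrite E.
by apply: eq_bigr => t zt; case: ifP => _; [apply: IHz|rewrite raddf0].
Qed.

Lemma tail_sum_string j : (j < N)%N -> tail_sum_strings j.+1.
Proof.
elim: j => [|j IHj] lt_j; apply: tail_sum_stringsS => //.
  exact: chain_sum_strings0.
exact/chain_sum_stringsS/IHj/ltnW.
Qed.

Lemma tail_sum_simple s : pos s ->
  ('X_lo ^+ N - 'X_hi ^+ N) * tail_sum N (sp s)
  = 'X_hi ^+ N * (tail_sum N s - sw (tail_sum N s)).
Proof.
move=> ps; have [|/(_ s ps) + _] := @tail_sum_string N.-1; first by rewrite prednK.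
rewrite prednK // subnn mul0n mod0n /string_rel subn0 expr0 mul1r => ->.
by rewrite mulrBr.
Qed.

End SimpleReflection.

Lemma chain1 k t : chain k 1%g t -> t = 1%g.
Proof.
case/connectP => [[|x q]] /= => [_ -> //|/andP[/achain_step_elim[] // _ _]].
by rewrite perm_length1.
Qed.

Lemma tail_sum_id j : (j <= N)%N -> (0 < j)%N -> tail_sum j 1%g = 'X_[lam *+ j].
Proof.
have w1 : wt 1%g = lam by apply/mnmP => u; rewrite weightE invg1 perm1.
elim: j => // j IHj lt_j _; rewrite tail_sumS // /chain_sum w1.
case: (posnP j) => [->|j_gt0]; first by rewrite mulr1 mulm1n.
rewrite (big_pred1 1%g) => [|t]; first by rewrite IHj ?(ltnW lt_j) // -mpolyXD mulmS.
by apply/idP/eqP => [/chain1 //|->]; exact: connect0.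
Qed.

End Tails.

(** * Lakshmibai-Seshadri paths *)

Section Paths.

Variables (n : nat) (lam : 'X_{1..n}) (N : nat).
Hypothesis lam_dom : dominant lam.
Hypothesis N_gt0 : (0 < N)%N.
Hypothesis lam_dvdN : forall u v, (lam v < lam u)%N -> (lam u - lam v %| N)%N.
Implicit Types (s t : 'S_n) (j k : nat) (p q : seq ('S_n * nat)).

Local Notation wt := (weight lam).
Local Notation chain := (chain lam N).
Local Notation tail_rel := (tail_rel lam N).
Local Notation is_tail := (is_tail lam N).
Local Notation tail_weight := (tail_weight lam).
Local Notation time k := (k%:R / N%:R : rat).

Definition path_of_tail p : path_data n :=
  (unzip1 p, [seq time k | k <- 0%N :: unzip2 p]).

Let N_neq0 : N%:R != 0 :> rat.
Proof. by rewrite pnatr_eq0 -lt0n. Qed.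

Lemma time_lt k l : (time k < time l) = (k < l)%N.
Proof. by rewrite ltr_pM2r ?invr_gt0 ?ltr0n // ltr_nat. Qed.

Lemma time_inj : injective (fun k => time k).
Proof. by move=> k l /(divIf N_neq0)/eqP; rewrite eqr_nat => /eqP. Qed.

Lemma path_of_tail_inj : injective path_of_tail.
Proof.
move=> p q [E1 /(inj_map time_inj) E2].
by rewrite -(zip_unzip p) -(zip_unzip q) E1 E2.
Qed.

Lemma tail_weightE k p u : path ltn k (unzip2 p) ->
  \sum_(j < size p)
    ([seq time l | l <- k :: unzip2 p]`_j.+1 - [seq time l | l <- k :: unzip2 p]`_j)
    * pact (nth 1%g (unzip1 p) j) (wvec lam) 0 u
  = (tail_weight k p u)%:R / N%:R.
Proof.
elim: p k => [|[s l] p IHp] k /=; first by rewrite big_ord0 mnm0E mul0r.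
case/andP=> lt_kl /IHp {}IHp; rewrite big_ord_recl /=.
rewrite [X in _ + X](_ : _ = (tail_weight l p u)%:R / N%:R); last by rewrite -IHp.
rewrite pact_weight mnmDE mulmnE natrD natrM natrB ?(ltnW lt_kl) //.
by rewrite -mulrBl; field.
Qed.

Lemma chain_bruhat k s t : chain k s t -> connect (@bruhat_step n) t s.
Proof.
move: s; apply: connect_ind_l => // s s' /and5P[_ _ /andP[_ s's] _ _] _ ts'.
exact: connect_trans ts' s's.
Qed.

Lemma has_achainP k s t : has_achain lam (time k) s t <-> chain k s t.
Proof.
split=> [[ks [pk <-]]|/connectP[ks pk ->]]; last by exists ks.
by apply/connectP; exists ks.
Qed.

(** The step makes the product of [a] and a difference of parts an integer, and that difference
    divides [N]. This is what confines turning times to multiples of 1 / N. *)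
Lemma achain_step_time a s t : achain_step lam a s t -> a * N%:R \is a Num.int.
Proof.
case/and5P=> ms mt _ /eqP El /existsP[u /existsP[v /and3P[lt_uv /eqP Et]]].
have lt_w : (wt s u < wt s v)%N.
  by apply: weight_lt_of_length; rewrite -?Et // El.
rewrite vdot_root_vec !pact_weight {1 2}Et !weight_tperm tpermL tpermR.
rewrite -natrB ?(ltnW lt_w) // => a_int.
have /dvdnP[m ->] : (wt s v - wt s u %| N)%N by apply: weight_dvdN.
by rewrite natrM mulrCA rpredM // ; apply: intr_nat.
Qed.

Lemma has_achain_time a s t : s != t -> has_achain lam a s t ->
  a * N%:R \is a Num.int.
Proof.
move=> ne_st [[|x ks] [/= + E]]; first by rewrite E eqxx in ne_st.
by case/andP=> /achain_step_time.
Qed.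

Lemma tail_path_min_rep x p : path tail_rel x p -> min_rep lam x.1 ->
  all (min_rep lam) (unzip1 (x :: p)).
Proof.
elim: p x => [|y p IHp] x /=; first by move=> _ ->.
case/andP=> /and3P[_ _ ch] py mx; rewrite mx /=.
exact: (IHp y py (chain_min_rep lam_dom N_gt0 ch mx)).
Qed.

Lemma is_tail_times k s p : is_tail k s p -> path ltn k (unzip2 p).
Proof.
case: p => [|[t l] p] //= /and4P[_ -> /= + _].
by elim: p s l => [|[u m] p IHp] s l //= /andP[/and3P[/= -> _ _] /IHp].
Qed.

Lemma LS_path_of_tail s p : min_rep lam s -> is_tail 0 s p ->
  LS_paths_from lam s (path_of_tail p).
Proof.
move=> ms tp; have ltp := is_tail_times tp; split; last first.
  by case: p tp {ltp} => [|[t l] p] //= /andP[/eqP->].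
split; last first.
  move=> i; rewrite size_map => lt_i.
  rewrite /path_of_tail /= -map_comp.
  rewrite !(nth_map (1%g, 0%N)) ?(ltnW lt_i) //=.
  case: p tp lt_i {ltp} => [|[t l] p] //= /and4P[/eqP-> _ pp _]; rewrite ltnS => lt_i.
  by have /and3P[_ _ /has_achainP] := pathP (1%g, 0%N) pp i lt_i.
case: p tp ltp => [|[t l] p] //= /and4P[/eqP-> l_gt0 pp /eqP lN] /= /andP[_ ltp].
apply/and5P; split => //.
- exact: tail_path_min_rep pp ms.
- apply: (homo_path (f := fst) _ pp) => x y /and3P[_ ne_xy ch].
  by rewrite /bruhat_lt ne_xy /= (chain_bruhat ch).
- by rewrite /= !size_map.
- by rewrite /= mul0r.
apply/andP; split.
  rewrite /= (last_map (fun k => time k)) /=.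
  have -> : last l (unzip2 p) = N by rewrite -[RHS]lN -(last_map snd).
  by rewrite divff.
rewrite /= time_lt l_gt0 /=.
by apply: (homo_path (f := fun k => time k) _ ltp) => x y; rewrite time_lt.
Qed.

Lemma tail_of_LS_path s (c : path_data n) : LS_paths_from lam s c ->
  exists2 p, is_tail 0 s p & c = path_of_tail p.
Proof.
case: c => ts [|a0 ts2] [[]]; first by case/and5P.
case/and5P=> /= mts srt_ts szE /eqP a00 /andP[/eqP last1 srt_a].
rewrite a00 {a0 a00} in last1 srt_a * => ach hd_ts.
case: ts hd_ts mts srt_ts szE ach => [|_ ts] //= [->] /andP[ms mts] srt_ts.
case: ts2 last1 srt_a => [|a ats] //=.
rewrite eqSS => last1 /andP[a_gt0 srt_a] /eqP [sz_ats] ach.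
(* Before the last index, the chain at time [a_j] joins distinct elements, so [has_achain_time]
   applies; the last time is 1. *)
have nat_a j : (j < size (a :: ats))%N -> (a :: ats)`_j * N%:R \is a Num.nat.
  move=> lt_j; rewrite natrEint; apply/andP; split; last first.
    rewrite mulr_ge0 ?ler0n // ltW //.
    have := order_path_min lt_trans srt_a => /allP min_a.
    have : (a :: ats)`_j \in a :: ats by rewrite mem_nth.
    by rewrite inE => /orP[/eqP->//|/min_a]; apply: lt_trans.
  case: (ltngtP j (size ats)) lt_j => [lt_j _|lt_j|-> _] /=; last 2 first.
  - by rewrite ltnS leqNgt lt_j.
  - by rewrite (last_nth 0) in last1; rewrite last1 mul1r; apply: intr_nat.
  have lt_j' : (j < size ts)%N by rewrite -sz_ats.
  apply: has_achain_time (ach j _) => //.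
  have /(pathP 1%g)/(_ j lt_j')/andP[+ _] := srt_ts.
  by rewrite eq_sym.
pose ks := [seq Num.truncn (b * N%:R) | b <- a :: ats].
have ksE : a :: ats = [seq time k | k <- ks].
  apply: (@eq_from_nth _ 0) => [|j lt_j]; first by rewrite !size_map.
  rewrite (nth_map 0%N) ?size_map // (nth_map 0) //.
  by rewrite truncnK ?nat_a // mulfK.
have [k0 [ks' Eks]] : exists k0 ks', ks = k0 :: ks' by rewrite /ks; do 2!eexists.
move: ksE; rewrite Eks => -[Ea Eats].
have sz_ks : size ks' = size ts by rewrite -sz_ats Eats size_map.
exists (zip (s :: ts) (k0 :: ks')); last first.
  by rewrite /path_of_tail unzip1_zip ?unzip2_zip /= ?sz_ks // mul0r -Ea -Eats.
apply/and4P; split=> //.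
- by rewrite -time_lt mul0r -Ea.
- apply/(pathP (1%g, 0%N)) => j; rewrite size_zip sz_ks minnn => lt_j.
  rewrite -/(zip (s :: ts) (k0 :: ks')) !nth_zip ?sz_ks //= ?sz_ks //.
  have /(pathP 1%g)/(_ j lt_j)/andP[ne_j _] := srt_ts.
  apply/and3P; split=> //=.
  + rewrite -time_lt.
    have /(pathP 0)/(_ j) := srt_a; rewrite sz_ats => /(_ lt_j).
    rewrite -[a :: ats]/([:: a] ++ ats) Ea Eats.
    rewrite -[_ ++ _]/([seq time k | k <- k0 :: ks']).
    by rewrite !(nth_map 0%N) //= ?sz_ks // ltnW.
  + apply/has_achainP; have := ach j; rewrite ltnS => /(_ lt_j).
    rewrite -[a :: ats]/([:: a] ++ ats) Ea Eats.
    rewrite -[_ ++ _]/([seq time k | k <- k0 :: ks']).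
    by rewrite (nth_map 0%N) //= sz_ks ltnW.
- apply/eqP/time_inj => /=; transitivity (last a ats); last by rewrite last1 divff.
  rewrite Ea Eats.
  rewrite (last_map (fun k => time k)) -(last_map snd) -/(unzip2 _).
  by rewrite unzip2_zip ?sz_ks.
Qed.

Lemma path_exponent_tail s p : min_rep lam s -> is_tail 0 s p ->
  (path_exponent lam (path_of_tail p) *+ N)%MM = tail_weight 0 p.
Proof.
move=> ms tp; have [LSp _] := LS_path_of_tail ms tp.
apply/mnmP => u; apply/eqP; rewrite mulmnE -(eqr_nat rat) natrM.
rewrite -path_exponentE // path_at1; last by case: LSp.
rewrite summxE size_map; under eq_bigr do rewrite mxE.
by rewrite tail_weightE ?(is_tail_times tp) // mulfVK.
Qed.

Definition LS_sum s : {mpoly int[n]} :=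
  \sum_(c \in LS_paths_from lam s) ('X_[path_exponent lam c] : {mpoly int[n]}).

(** The encoding is a bijection from a duplicate-free list, which also shows that there are finitely
    many paths. *)
Lemma LS_sumE s : min_rep lam s ->
  LS_sum s = \sum_(p <- tails lam N N s) 'X_[path_exponent lam (path_of_tail p)].
Proof.
move=> ms; rewrite /LS_sum.
have -> : LS_paths_from lam s = [set` map path_of_tail (tails lam N N s)]%classic.
  apply/seteqP; split=> c /=.
    case/tail_of_LS_path=> p tp ->; apply: map_f.
    by rewrite tailsP // subnn.
  case/mapP=> p; rewrite tailsP // subnn => tp ->.
  exact: LS_path_of_tail.
rewrite -fsbig_seq ?big_map // map_inj_uniq ?tails_uniq //.
exact: path_of_tail_inj.
Qed.

End Paths.

(** * The substitution of N-th powers for the variables *)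

Section Dilation.

Variables (n N : nat).
Hypothesis N_gt0 : (0 < N)%N.
Implicit Types f : {mpoly int[n]}.

Definition dilate f : {mpoly int[n]} := f \mPo [tuple 'X_i ^+ N | i < n].

Lemma dilateX (m : 'X_{1..n}) : dilate 'X_[m] = 'X_[m *+ N].
Proof.
rewrite /dilate comp_mpolyX [RHS]mpolyXE_id; apply: eq_bigr => u _.
by rewrite tnth_mktuple -exprM mulmnE mulnC.
Qed.

Lemma dilateM : {morph dilate : f g / f * g}.
Proof. exact: rmorphM. Qed.

Lemma dilateB : {morph dilate : f g / f - g}.
Proof. exact: comp_mpolyB. Qed.

Lemma mcoeff_dilate f (m : 'X_{1..n}) : (dilate f)@_(m *+ N) = f@_m.
Proof.
elim/mpolyind: f => [|c m' f _ _ IHf]; first by rewrite /dilate raddf0 !mcoeff0.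
rewrite /dilate comp_mpolyD comp_mpolyZ -!/(dilate _) dilateX.
rewrite !mcoeffD !mcoeffZ IHf !mcoeffX; congr (_ * _%:R + _).
congr (nat_of_bool _); apply/eqP/eqP => [/mnmP E|-> //]; apply/mnmP => u.
by have := E u; rewrite !mulmnE => /eqP; rewrite eqn_pmul2r // => /eqP.
Qed.

Lemma dilate_inj : injective dilate.
Proof.
by move=> f g E; apply/mpolyP => m; rewrite -(mcoeff_dilate f) E mcoeff_dilate.
Qed.

Lemma msym_dilate (s : 'S_n) f : msym s (dilate f) = dilate (msym s f).
Proof.
elim/mpolyind: f => [|c m f _ _ IHf]; first by rewrite /dilate !raddf0.
rewrite /dilate comp_mpolyD comp_mpolyZ -!/(dilate _) dilateX.
rewrite !msymD !msymZ IHf !msymX /dilate comp_mpolyD comp_mpolyZ -!/(dilate _) dilateX.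
by congr (_ *: 'X_[_] + _); apply/mnmP => u; rewrite !(mnmE, mulmnE).
Qed.

End Dilation.

Lemma demazure_bpiP (n : nat) (i : 'I_n.-1) (f : {mpoly int[n]}) :
  ('X_(simple_lo i) - 'X_(simple_hi i)) * demazure_bpi i f
  = 'X_(simple_hi i) * (f - msym (simple_perm i) f).
Proof.
rewrite /demazure_bpi mulrBr ddiffP msymM sw_Y.
by ring.
Qed.

(** * Demazure atoms as sums over LS-paths *)

Section Atoms.

Variables (n : nat) (lam : 'X_{1..n}).
Hypothesis lam_dom : dominant lam.

(** Every positive difference of parts is at most the size of the partition, so it divides this
    factorial. *)
Let N := (mdeg lam)`!.

Let N_gt0 : (0 < N)%N.
Proof. exact: fact_gt0. Qed.

Let lam_dvdN (u v : 'I_n) : (lam v < lam u)%N -> (lam u - lam v %| N)%N.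
Proof.
move=> lt_vu; apply: dvdn_fact; rewrite subn_gt0 lt_vu /=.
apply: leq_trans (leq_subr _ _) _; rewrite mdegE (bigD1 u) //=.
exact: leq_addr.
Qed.

Lemma dilate_LS_sum s : min_rep lam s -> dilate N (LS_sum lam s) = tail_sum lam N N s.
Proof.
move=> ms; rewrite (LS_sumE lam_dom N_gt0 lam_dvdN ms) /dilate raddf_sum.
rewrite /tail_sum subnn.
rewrite !big_seq; apply: eq_bigr => p; rewrite tailsP // subnn => tp.
by rewrite -[LHS]/(dilate N _) dilateX (path_exponent_tail lam_dom N_gt0 ms tp).
Qed.

Lemma LS_sum_id : LS_sum lam 1%g = 'X_[lam].
Proof.
have m1 : min_rep lam 1%g by apply/forallP => h; rewrite perm_length1 implybT.
apply: (dilate_inj N_gt0).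
by rewrite dilate_LS_sum // dilateX tail_sum_id.
Qed.

Lemma LS_sum_simple i s : pos lam i s ->
  LS_sum lam (pcomp (simple_perm i) s) = demazure_bpi i (LS_sum lam s).
Proof.
move=> ps; apply: (mulfI (mpolyX_simple_neq i)); rewrite demazure_bpiP.
apply: (dilate_inj N_gt0); have dil u : dilate N 'X_u = 'X_u ^+ N :> {mpoly int[n]}.
  by rewrite dilateX mpolyXn.
have /andP[ms _] := ps; have /andP[ms' _] := pos_sp lam_dom ps.
rewrite !(dilateM, dilateB) -msym_dilate !dil.
by rewrite !dilate_LS_sum // tail_sum_simple.
Qed.

Lemma demazure_bpi_word_LS_sum (w : seq 'I_n.-1) :
  min_rep lam (word_perm w) -> size w = perm_length (word_perm w) ->
  demazure_bpi_word w 'X_[lam] = LS_sum lam (word_perm w).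
Proof.
elim: w => [_ _|i w IHw] /=; first by rewrite LS_sum_id.
set s := word_perm w => ms sz.
(* A descent here would give [s] length [size w + 2], although [w] is a word for it. *)
have lt_s : ((s^-1)%g (simple_lo i) < (s^-1)%g (simple_hi i))%N.
  have := length_word_le w; rewrite -/s => le_s.
  case: (ltngtP ((s^-1)%g (simple_lo i))) => // [lt_s|/val_inj/perm_inj/(congr1 val)].
    by have := perm_length_desc lt_s; lia.
  by move=> /= ?; lia.
have lenE := perm_length_simple lt_s.
(* Minimality turns the descent of the product into a strict inequality of weights; hence [s] is
   [pos], in particular again minimal. *)
have ns : neg lam i (pcomp (simple_perm i) s).
  rewrite /neg ms weight_ltE // ?simple_lo_lt_hi //.
  by rewrite /pcomp invMg !permM tpermV tpermL tpermR.
have ps : pos lam i s by have := neg_sp lam_dom ns; rewrite simple_permK.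
rewrite IHw; first by rewrite LS_sum_simple.
  by case/andP: ps.
by move: sz; rewrite lenE => -[].
Qed.

End Atoms.

Lemma pad_dominant (n : nat) (lam : seq nat) :
  is_partition lam -> dominant (pad n lam).
Proof.
case/andP=> srt _ p q le_pq; rewrite !mnmE.
case: (ltnP q (size lam)) => [lt_q|le_q]; last by rewrite [X in (X <= _)%N]nth_default.
apply: (sorted_leq_nth (leT := geq)) => //.
- by move=> x y z /= le1 le2; apply: leq_trans le2 le1.
- by move=> x /=.
- by rewrite inE; apply: leq_ltn_trans lt_q.
Qed.

Theorem proposition3p4p3 (n : nat) (lam : seq nat) (tau : 'S_n)
    (w : seq 'I_n.-1) :
  is_partition lam -> (size lam <= n)%N ->
  min_rep (pad n lam) tau ->
  reduced_word w tau ->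
  demazure_bpi_word w 'X_[pad n lam]
  = \sum_(p \in LS_paths_from (pad n lam) tau)
      ('X_[path_exponent (pad n lam) p] : {mpoly int[n]}).
Proof.
move=> /(@pad_dominant n) dom _ mtau /andP[/eqP Ew /eqP szw].
by rewrite demazure_bpi_word_LS_sum ?Ew.
Qed.
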